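(* Fix positive constants $A, A'$. Let $C(x)$ denote the number of Carmichael numbers $n \le x$ all of whose prime divisors $p$ satisfy $(p-1)/2 \in \mathcal{S}$. For each $E \in \mathcal{E} \cap (4/9,1)$, each $B \in \mathcal{B}(A,A')$ and each $\epsilon > 0$, there is a number $x_4(E,B,\epsilon)$ such that $C(x) \ge x^{EB - \epsilon}$ for all $x \ge x_4(E,B,\epsilon)$.
   Context: A Carmichael number is a composite positive integer $n$ with $a^n\equiv a \pmod n$ for all integers $a$. Let $\mathcal{S} = \{1,5,13,17,25,\dots\}$ be the multiplicative semigroup of positive integers generated by the primes $p \equiv 1 \pmod 4$, and $\mathbf{1}_{\mathcal{S}}$ its indicator function; $\mathbf{1}_{\mathbb{P}}$ is the indicator of the set of primes, $\pi(x)$ the prime counting function, $\phi$ Euler's function, $\mu$ the Möbius function, $P^+(n)$ the greatest prime divisor of $n$ ($P^+(1)=1$). Let $\log_1 x = \max\{1,\log x\}$ and $\log_2 x = \log_1(\log_1 x)$. Let $\pi(x,y) = \#\{p \in \mathcal{S}\cap[2,x] \text{ prime}: P^+(p-1)\le y\}$ (note primes in $\mathcal S$ are exactly the primes $\equiv 1 \pmod 4$). Let $\mathcal{E}$ be the set of $E \in (0,1)$ for which there exist $x_1(E), \gamma_1(E) > 0$ such that $\pi(x, x^{1-E}) \ge \gamma_1(E)\pi(x)$ for all $x \ge x_1(E)$. Exceptional modulus: let $c>0$ be a certain fixed small absolute constant for which the following holds (as shown by Banks–Freiberg–Maynard): for $T \ge 3$, among all primitive Dirichlet characters $\chi \bmod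 \ell$ with $\ell \le T$ and $P^+(\ell) \le T^{1/\log_2 T}$, at most one has $L(s,\chi)$ vanishing in the region $\mathrm{Re}(s) > 1 - c\log_2 T/\log T$, $|\mathrm{Im}(s)| \le \exp(\sqrt{\log T}/\log_2 T)$. If such a character $\chi \bmod \ell$ exists, set $\ell(T) = \ell$; otherwise set $\ell(T)=1$. For positive constants $A,A'$, let $\mathcal{B}(A,A')$ be the set of $B\in(0,1)$ for which there exists $x_2(B)$ such that for all $x\ge x_2(B)$, $$\frac{A^{-1} d x^{1-B} y^{-1}}{\phi(d)\log(d x^{1-B})} \le \sqrt{\log x}\sum_{\kappa \le x^{1-B}y^{-1}} \mathbf{1}_{\mathcal S}(\kappa)\mathbf{1}_{\mathbb P}(2d\kappa+1) \le \frac{A' d x^{1-B} y^{-1}}{\phi(d)\log(d x^{1-B})}$$ holds whenever $d \in \mathcal{S}\cap[1,x^B y]$, $|\mu(d)|=1$, $P^+(d) \le x^{B/\log_2 x}$, $y$ is a positive real with $y \le x^{B/\log_2 x}$, and $\gcd(d,\ell(x^B))=1$. *)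

(* Defs.v *)
From Stdlib Require Import Reals ZArith ClassicalEpsilon.
From Coquelicot Require Import Coquelicot.
From mathcomp Require Import ssreflect ssrfun ssrbool eqtype ssrnat seq div prime.

Set Implicit Arguments.
Unset Strict Implicit.
Unset Printing Implicit Defensive.

Local Open Scope R_scope.

Definition log1 (x : R) : R := Rmax 1 (ln x).
Definition log2 (x : R) : R := log1 (log1 x).

Definition pb (P : Prop) : bool :=
  if excluded_middle_informative P then true else false.

Definition count_le (x : R) (P : nat -> Prop) : nat :=
  count (fun n => pb (P n)) (iota 1 (Z.to_nat (Int_part x))).

(* S = multiplicative semigroup generated by the primes p = 1 (mod 4)
   (it contains 1 = empty product). *)
Definition inS (n : nat) : Prop :=
  (0 < n)%N /\ forall p : nat, prime p -> (p %| n)%N -> (p %% 4 = 1)%N.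

Definition composite (n : nat) : Prop := (1 < n)%N /\ ~~ prime n.

Definition carmichael (n : nat) : Prop :=
  composite n /\
  forall a : Z, (Z.of_nat n | (a ^ Z.of_nat n - a))%Z.

Definition good_carmichael (n : nat) : Prop :=
  carmichael n /\
  forall p : nat, prime p -> (p %| n)%N -> inS ((p - 1) %/ 2)%N.

Definition Ccount (x : R) : nat := count_le x good_carmichael.

Definition prime_pi (x : R) : nat := count_le x (fun p => prime p).

Definition pi2 (x y : R) : nat :=
  count_le x (fun p => prime p /\ inS p /\ INR (max_pdiv (p - 1)) <= y).

Definition inE (E : R) : Prop :=
  0 < E < 1 /\
  exists x1 gamma1 : R, 0 < x1 /\ 0 < gamma1 /\
    forall x : R, x1 <= x ->
      INR (pi2 x (Rpower x (1 - E))) >= gamma1 * INR (prime_pi x).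

Definition dchar (q : nat) (chi : nat -> C) : Prop :=
  (0 < q)%N /\
  chi 1%N = 1%C /\
  (forall m n : nat, chi (m * n)%N = (chi m * chi n)%C) /\
  (forall n : nat, chi (n + q)%N = chi n) /\
  (forall n : nat, chi n = 0%C <-> ~~ coprime n q).

(* primitive: not induced by a character to a proper divisor d of q *)
Definition primitive_dchar (q : nat) (chi : nat -> C) : Prop :=
  dchar q chi /\
  ~ (exists d : nat, (d %| q)%N /\ (d < q)%N /\
       forall n : nat, coprime n q -> (n %% d = 1 %% d)%N -> chi n = 1%C).

Definition npow_neg (n : nat) (s : C) : C :=
  let l := ln (INR n) in
  (exp (- fst s * l) * cos (snd s * l), - (exp (- fst s * l) * sin (snd s * l))).

Fixpoint Lpartial (chi : nat -> C) (s : C) (N : nat) : C :=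
  match N with
  | O => 0%C
  | S k => (Lpartial chi s k + chi (S k) * npow_neg (S k) s)%C
  end.

(* L(s,chi) = 0, for a primitive character chi mod q and Re s > 0, s <> 1.
   For Re s > 0, s <> 1, the analytic continuation of L(s,chi) equals
     lim_N ( sum_{n<=N} chi(n) n^{-s} - [q = 1] N^{1-s}/(1-s) )
   (for q >= 2 chi is non-principal and the series converges;
    for q = 1, L = zeta and this is the classical formula for zeta). *)
Definition L_vanishes (q : nat) (chi : nat -> C) (s : C) : Prop :=
  s <> 1%C /\
  is_lim_seq
    (fun N : nat =>
       Cmod (Lpartial chi s N -
             (if (q == 1)%N
              then (INR N * npow_neg N s) / (1 - s)
              else 0))%C) 0.

Definition exceptional (c T : R) (l : nat) (chi : nat -> C) : Prop :=
  3 <= T /\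
  primitive_dchar l chi /\
  INR l <= T /\
  INR (max_pdiv l) <= Rpower T (1 / log2 T) /\
  exists s : C,
    fst s > 1 - c * log2 T / ln T /\
    Rabs (snd s) <= exp (sqrt (ln T) / log2 T) /\
    L_vanishes l chi s.

(* The Banks--Freiberg--Maynard property of the constant c:
   for T >= 3 at most one such primitive character exists. *)
Definition BFM_property (c : R) : Prop :=
  forall (T : R) (l1 l2 : nat) (chi1 chi2 : nat -> C),
    exceptional c T l1 chi1 -> exceptional c T l2 chi2 ->
    l1 = l2 /\ (forall n, chi1 n = chi2 n).

Definition is_ell (c T : R) (l : nat) : Prop :=
  (exists chi, exceptional c T l chi) \/
  (l = 1%N /\ ~ exists l' chi, exceptional c T l' chi).

Definition ell (c T : R) : nat :=
  epsilon (inhabits 1%N) (fun l => is_ell c T l).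

Definition squarefree (d : nat) : Prop :=
  forall p : nat, prime p -> ~ (p * p %| d)%N.

Definition kappa_sum (X : R) (d : nat) : nat :=
  count_le X (fun k => inS k /\ prime (2 * d * k + 1)).

Definition inB (c A A' B : R) : Prop :=
  0 < B < 1 /\
  exists x2 : R, forall x : R, x2 <= x ->
    forall (d : nat) (y : R),
      inS d -> INR d <= Rpower x B * y ->
      squarefree d ->
      INR (max_pdiv d) <= Rpower x (B / log2 x) ->
      0 < y -> y <= Rpower x (B / log2 x) ->
      coprime d (ell c (Rpower x B)) ->
      let X := Rpower x (1 - B) / y in
      let main := INR d * X / (INR (totient d) * ln (INR d * Rpower x (1 - B))) in
      / A * main <= sqrt (ln x) * INR (kappa_sum X d) /\
      sqrt (ln x) * INR (kappa_sum X d) <= A' * main.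

(* Main.v *)
(** A variant of the Alford-Granville-Pomerance construction. Put [W = ln ln X],
    [ln x = W^(1+d)] and [z = W^((1-d)/(1-E))] for a small [d > 0]. By the definition
    of [inE], many primes [q <= z] congruent to 1 mod 4 have [q - 1] free of prime
    factors exceeding [z^(1-E) = W^(1-d)]; keep a set [Q] of [z^(1-2d)] of them, all
    exceeding [z^(1-d)] and none dividing the exceptional modulus. The products [d <= x^B]
    of [u] elements of [Q] then number about [x^(EB)].

    The lower bound in [inB], summed over these [d], and the pigeonhole principle give one
    [k] for which [p = 2dk+1] is prime for [x^(EB-o(1))] of them. The upper bound in
    [inB], used with [dq] and [y = q], discards the pairs [(d,k)] for which some [q] in [Q]
    divides [k] but not [d]. So the product [G] of the [q] in [Q] dividing [k] divides every
    surviving [d], and each such [p] is 1 modulo [2kG], a number coprime to the product [L]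
    of the [q] in [Q] not dividing [k]. Hence a product [N] of primes [p] with [N = 1 mod L] satisfies
    Korselt's criterion.

    As [q - 1] is smooth for every [q] in [Q], the exponent [m] of the group of units
    mod [L] is only [exp(o(W))], so any [n = exp(o(W))] units have a nonempty subproduct
    equal to 1. Therefore every [t]-subset of the [r] primes [p] contains a
    subset with product 1 mod [L] and at least [t - n] elements, which yields at least
    [C(r,t) / (r+1)^n] Carmichael numbers up to [(3x)^t]; take [t = ln X / ln (3x)]. *)
Require Import Defs.
From Stdlib Require Import ZArith Zpow_facts Reals Lra Lia ClassicalEpsilon.
From Coquelicot Require Import Rcomplements.
From mathcomp Require Import all_boot all_order all_algebra all_fingroup.
From mathcomp Require Import all_solvable all_field all_character zify.
Set Implicit Arguments.
Unset Strict Implicit.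
Unset Printing Implicit Defensive.
Import GRing.Theory.
Local Open Scope nat_scope.

(** * Subproducts equal to one in finite abelian groups *)

Lemma popular_value (T : finType) (A : {set T}) m (h : T -> 'I_m.+1) :
  exists k, #|A| <= #|[set x in A | h x == k]| * m.+1.
Proof.
apply/existsP/contraT; rewrite negb_exists => /forallP H.
have E: #|A| = \sum_(k < m.+1) #|[set x in A | h x == k]|.
  rewrite -sum1_card (partition_big h predT) //=.
  by apply: eq_bigr => k _; rewrite -sum1_card; apply: eq_bigl => x; rewrite inE.
have: (#|A| * m.+1 < #|A| * m.+1).
  rewrite {1}E big_distrl /=.
  apply: (@leq_ltn_trans (\sum_(k < m.+1) (#|A| .-1))).
    by apply: leq_sum => k _; move: (H k); lia.
  rewrite sum_nat_const card_ord; move: (H ord0); lia.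
by rewrite ltnn.
Qed.

(* Each [a x] is the most frequent value of ['chi_c (f x)] among the characters still
   alive, so it kills at least one character in [m.+1]. *)
Lemma greedy_annihilator (gT : finGroupType) (G : {group gT}) (m : nat)
    (I : finType) (f : I -> gT) (r : seq I) :
  abelian G -> (forall g, g \in G -> (g ^+ m.+1 = 1)%g) ->
  (forall i, i \in r -> f i \in G) -> uniq r ->
  exists a : I -> algC, (forall i, a i != 0)%R /\
    #|[set c : Iirr G | (\prod_(i <- r) (a i - 'chi_c (f i)) != 0)%R]|
      * m.+1 ^ size r <= #|G| * m ^ size r.
Proof.
move=> abG expG; elim: r => [|x r IH] fG.
  exists (fun=> 1%R); split=> [i|]; first exact: oner_neq0.
  by rewrite !expn0 !muln1 -(card_Iirr_abelian abG) max_card.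
move=> /= /andP [xr ur].
have [i ir|//|a [a0 Ha]] := IH; first by apply: fG; rewrite inE ir orbT.
set A := [set c | _] in Ha.
have [w w_prim] := C_prim_root_exists (ltn0Sn m).
have linG := char_abelianP G abG.
have fx : f x \in G by apply: fG; rewrite inE eqxx.
have chi_root (c : Iirr G) : ('chi_c (f x) ^+ m.+1 = 1)%R.
  by rewrite -lin_charX // expG // lin_char1.
pose h c := sval (prim_rootP w_prim (chi_root c)).
have hE c : ('chi_c (f x) = w ^+ h c)%R by rewrite /h; case: prim_rootP.
have [k Hk] := popular_value A h.
(* As [x] does not occur in [r], the new value at [x] leaves the product over [r] unchanged. *)
exists (fun i => if i == x then (w ^+ k)%R else a i); split.
  move=> i; case: (i == x) => //; apply: expf_neq0.
  by apply/eqP => w0; move: (prim_expr_order w_prim); rewrite w0 expr0n /= => /esym/eqP; rewrite oner_eq0.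
have sub : [set c : Iirr G | (\prod_(i <- x :: r) ((if i == x then w ^+ k else a i) - 'chi_c (f i)) != 0)%R] \subset A :\: [set c in A | h c == k].
  apply/subsetP => c; rewrite !inE big_cons eqxx mulf_eq0 negb_or => /andP [H1 H2].
  have -> : (\prod_(i <- r) (a i - 'chi_c (f i)) != 0)%R.
    congr (_ != 0)%R: H2; apply: eq_big_seq => i ir /=.
    by case: eqP => // ix; rewrite -ix ir in xr.
  rewrite andbT /=; apply: contraNN H1 => /eqP <-; by rewrite hE subrr.
have := subset_leq_card sub; set B := [set c | (\prod_(i <- _ :: _) _ != 0)%R] => HB.
have : #|A :\: [set c in A | h c == k]| = #|A| - #|[set c in A | h c == k]|.
  by rewrite cardsD; congr (_ - #|pred_of_set _|); apply/setP=> c; rewrite !inE; case: (_ != _).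
move=> E; rewrite {}E in HB.
rewrite !expnS.
have: #|B| * m.+1 <= #|A| * m.
  apply: (leq_trans (leq_mul HB (leqnn _))); rewrite mulnBl [#|A| * m.+1]mulnS.
  by rewrite leq_subLR leq_add2r.
move=> Hb; rewrite mulnA; apply: (leq_trans (leq_mul Hb (leqnn _))).
by rewrite mulnAC [m * m ^ _]mulnC mulnA leq_mul2r Ha orbT.
Qed.

(* Expand the zero sum of [\prod_(i in A) (a i - 'chi_c (f i))] over all characters: by
   orthogonality the term of [J] vanishes unless the product of [f] off [J] is 1. *)
Lemma product_one_subset (gT : finGroupType) (G : {group gT}) (m : nat)
    (I : finType) (f : I -> gT) (A : {set I}) :
  abelian G -> (forall g, g \in G -> (g ^+ m.+1 = 1)%g) ->
  {in A, forall i, f i \in G} -> #|G| * m ^ #|A| < m.+1 ^ #|A| ->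
  exists J : {set I}, [/\ J \subset A, J != set0 & (\prod_(i in J) f i = 1)%g].
Proof.
move=> abG expG fG ltA.
have fE : forall i, i \in enum A -> f i \in G.
  by move=> i; rewrite mem_enum; exact: fG.
have [a [a0 Ha]] := greedy_annihilator abG expG fE (enum_uniq _).
(* The number of surviving characters is at most [#|G| * (m / m.+1) ^ #|A|], which is below 1, so
   none survives. *)
have {}Ha : forall c : Iirr G, (\prod_(i in A) (a i - 'chi_c (f i)) = 0)%R.
  move=> c; apply/eqP/negPn/negP => Hc.
  move: Ha; rewrite -cardE leqNgt => /negP; apply; apply: (leq_trans ltA).
  rewrite -[X in X <= _]mul1n leq_mul2r; apply/orP; right.
  by apply/card_gt0P; exists c; rewrite inE big_enum.
have linG := char_abelianP G abG.
case: (pickP (fun J : {set I} => [&& J \subset A, J != set0 & (\prod_(i in J) f i == 1)%g])) => [J /and3P[H1 H2 /eqP H3]|none].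
  by exists J.
exfalso.
(* Outside [A] the two summands are 1 and 0, so the product can be expanded over all subsets of
   [I]. *)
pose F i : algC := if i \in A then a i else 1%R.
pose H (c : Iirr G) i : algC := (if i \in A then - 'chi_c (f i) else 0)%R.
have : (\sum_(c : Iirr G) \prod_(i in A) (a i - 'chi_c (f i)) = 0)%R.
  by apply: big1.
have -> : (\sum_(c : Iirr G) \prod_(i in A) (a i - 'chi_c (f i)) =
  \sum_(J in {set I}) \sum_(c : Iirr G) \prod_i (if i \in J then F i else H c i))%R.
  rewrite exchange_big /=; apply: eq_bigr => c _.
  rewrite -bigA_distr big_mkcond /=; apply: eq_bigr => i _.
  by rewrite /F /H; case: ifP => // _; rewrite addr0.
(* The term of [setT] is [#|G|] times a product of nonzero scalars; once all other terms vanish, it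
   contradicts the zero sum. *)
rewrite (bigD1 (setT : {set I})) //= [X in (_ + X)%R]big1 => [|J JT].
  rewrite addr0 (eq_bigr (fun=> \prod_i F i)%R) => [|c _]; last first.
    by apply: eq_bigr => i _; rewrite inE.
  rewrite sumr_const card_Iirr_abelian // => /eqP; rewrite -mulr_natr mulf_eq0.
  rewrite Num.Theory.pnatr_eq0 eqn0Ngt cardG_gt0 orbF => /prodf_eq0 [i _]; rewrite /F.
  by case: ifP => _; rewrite ?(negPf (a0 i)) // oner_eq0.
have [sJ|] := boolP (~: J \subset A); last first.
  case/subsetPn => i; rewrite inE => iJ iA.
  by apply: big1 => c _; rewrite (bigD1 i) //= (negPf iJ) /H (negPf iA) mul0r.
have splitJ (c : Iirr G) : (\prod_i (if i \in J then F i else H c i) =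
   (\prod_(i in J) F i * \prod_(i in ~: J) (-1)) * 'chi_c (\prod_(i in ~: J) f i)%g)%R.
  rewrite (bigID (mem J)) /= -mulrA; congr (_ * _)%R.
    by apply: eq_bigr => i ->.
  rewrite lin_char_prod //; last by move=> i iJ; apply: fG; apply: (subsetP sJ).
  rewrite -big_split /=.
  rewrite (eq_bigl (fun i => i \in ~: J)); last by move=> i; rewrite inE.
  apply: eq_bigr => i iJ; rewrite /H (subsetP sJ _ iJ).
  by move: iJ; rewrite inE => /negPf ->; rewrite mulN1r.
rewrite (eq_bigr _ (fun c _ => splitJ c)) -mulr_sumr.
suff -> : (\sum_(c : Iirr G) 'chi_c (\prod_(i in ~: J) f i)%g = 0)%R by rewrite mulr0.
(* The sum of the linear characters is the regular character, which vanishes away from 1. *)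
have := cfRegE G (\prod_(i in ~: J) f i)%g; rewrite cfReg_sum sum_cfunE.
have -> : ((\prod_(i in ~: J) f i == 1)%g = false).
  apply/negP => J1; move: (none (~: J)); rewrite sJ J1 andbT /=.
  by move/negbT; rewrite negbK => /eqP J0; move: JT; rewrite -(setCK J) J0 setC0 eqxx.
rewrite mulr0n => E; rewrite -[RHS]E; apply: eq_bigr => c _.
by rewrite cfunE lin_char1 // mul1r.
Qed.

(** The first two terms of the binomial expansion of [(m + 1) ^ m.+1] suffice. In other words,
    [m.+1] factors [m / m.+1] multiply to at most one half. *)
Lemma two_mul_expn_pred m : 2 * m ^ m.+1 <= m.+1 ^ m.+1.
Proof.
case: m => // m.
rewrite -[X in _ <= X ^ _]addn1.
rewrite expnDn big_ord_recl big_ord_recl /= /bump /= !exp1n !muln1 !bin0 bin1 mul1n.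
rewrite subn0 mul2n -addnn leq_add2l addn0 subSS subn0.
by rewrite (leq_trans _ (leq_addr _ _)) // [X in X <= _]expnS leq_mul2r leqnSn orbT.
Qed.

(** Each of the [k] blocks of [m.+1] factors [m / m.+1] halves [L] at least once. *)
Lemma exponent_growth L k m : L < 2 ^ k -> L * m ^ (m.+1 * k) < m.+1 ^ (m.+1 * k).
Proof.
move=> Lk; case: m => [|m].
  rewrite !exp1n mul1n; case: k Lk => [|k] Lk; last by rewrite exp0n // muln0.
  by rewrite muln1.
rewrite !expnM; apply: (@leq_trans (2 ^ k * (m.+1 ^ m.+2) ^ k)).
  by rewrite ltn_mul2r Lk andbT expn_gt0 expn_gt0.
by rewrite -expnMn; case: k {Lk} => // k; rewrite leq_exp2r ?two_mul_expn_pred.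
Qed.

(** The units of ['Z_L] form an abelian group of order at most [L] and exponent dividing [m]; by
    [exponent_growth], [m * k] of them meet the size condition of [product_one_subset]. *)
Lemma product_one_subset_mod (L m k : nat) (I : finType) (g : I -> nat)
    (A : {set I}) :
  0 < L -> 0 < m -> (forall a, coprime a L -> a ^ m = 1 %[mod L]) ->
  {in A, forall i, coprime (g i) L} -> L < 2 ^ k -> m * k <= #|A| ->
  exists J : {set I}, [/\ J \subset A, J != set0 &
    \prod_(i in J) g i = 1 %[mod L]].
Proof.
case: m => // m L0 _ expm cop Lk mkA.
(* ['Z_1] is the ring of integers mod 2, so [L = 1] is treated apart; there [A] itself works, being
   nonempty because [1 < 2 ^ k] forces [k > 0]. *)
have [L1|L1] := leqP L 1.
  have L_eq : L = 1 by lia.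
  exists A; split=> //; last by rewrite L_eq !modn1.
  by rewrite -card_gt0; case: k mkA Lk => [|k] mkA Lk; rewrite ?L_eq // in Lk *; lia.
pose f i : {unit 'Z_L} := insubd (1%g : {unit 'Z_L}) ((g i)%:R%R : 'Z_L).
have fE i : i \in A -> val (f i) = (g i)%:R%R.
  by move=> iA; rewrite val_insubd unitZpE // coprime_sym cop.
have valX (u : {unit 'Z_L}) j : val (u ^+ j)%g = (val u ^+ j)%R.
  by elim: j => [|j IH] //; rewrite expgS exprS -IH.
have expG (u : {unit 'Z_L}) : u \in [set: {unit 'Z_L}] -> (u ^+ m.+1 = 1)%g.
  move=> _; apply: val_inj; rewrite valX /=.
  have E : ((val u : nat)%:R = val u)%R by apply: natr_Zp.
  have cu : coprime (val u : nat) L.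
    by rewrite coprime_sym -unitZpE // E; exact: valP.
  by rewrite -E -natrX -(Zp_nat_mod L1) expm // Zp_nat_mod.
have := @product_one_subset _ [set: {unit 'Z_L}]%G m I f A.
case=> //.
- by apply/centsP => u _ v _; apply: val_inj; rewrite /= mulrC.
- by move=> i _; rewrite inE.
- have GL : #|[set: {unit 'Z_L}]| <= L.
    rewrite cardsT -[X in _ <= X](@Zp_cast L) // -[X in _ <= X]card_ord.
    by apply: (@leq_card _ _ val); apply: val_inj.
  apply: (@leq_ltn_trans (L * m ^ #|A|)); first by rewrite leq_mul2r GL orbT.
  rewrite -(subnKC mkA) (expnD m (m.+1 * k)) (expnD m.+1 (m.+1 * k)) mulnA.
  apply: (@leq_ltn_trans (L * m ^ (m.+1 * k) * m.+1 ^ (#|A| - m.+1 * k))).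
    rewrite leq_mul2l; apply/orP; right.
    by case: (_ - _) => // j; rewrite leq_exp2r.
  by rewrite ltn_mul2r expn_gt0 /= exponent_growth.
move=> J [sJ J0 J1]; exists J; split=> //.
have valp : val (\prod_(i in J) f i)%g = (\prod_(i in J) val (f i))%R.
  by apply: (big_morph val) => //.
move: (congr1 val J1); rewrite valp (eq_bigr (fun i => (g i)%:R)%R); last first.
  by move=> i iJ; apply: fE; apply: (subsetP sJ).
rewrite -natr_prod => J1R.
by have := val_Zp_nat L1 (\prod_(i in J) g i); rewrite J1R -(val_Zp_nat L1 1) => <-.
Qed.

(** A set of size [a] has at most [a ^ j] subsets of size [j]; since [C(n, j) >= 1] for [j <= n],
    their sum is dominated by the binomial expansion of [(a + 1) ^ n]. *)
Lemma card_small_subsets (T : finType) (A : {set T}) n :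
  #|[set B : {set T} | (B \subset A) && (#|B| <= n)]| <= #|A|.+1 ^ n.
Proof.
set X := [set B | _].
have -> : #|X| = \sum_(j < n.+1) 'C(#|A|, j).
  rewrite -sum1_card (partition_big (fun B : {set T} => inord #|B| : 'I_n.+1) predT) //=.
  apply: eq_bigr => j _; rewrite -cards_draws -sum1_card; apply: eq_bigl => B.
  rewrite !inE -andbA; case: (B \subset A) => //=.
  apply/andP/eqP => [[B1 /eqP <-]|E]; first by rewrite inordK.
  by rewrite E -ltnS ltn_ord; split=> //; apply/eqP/val_inj; rewrite /= inordK.
rewrite -[#|A|.+1]addn1 addnC expnDn; apply: leq_sum => j _.
rewrite exp1n mul1n.
have jn : j <= n by rewrite -ltnS ltn_ord.
apply: (@leq_trans (#|A| ^ j)); last by rewrite leq_pmull // bin_gt0.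
apply: (@leq_trans (#|A| ^_ j)); first by rewrite -bin_ffact leq_pmulr // fact_gt0.
elim: (nat_of_ord j) #|A| => // i IH [|a]; first by rewrite ffact0n exp0n.
rewrite ffactSS expnS leq_mul //; apply: (leq_trans (IH a)).
by case: i {IH} => // i; rewrite leq_exp2r.
Qed.

(* A maximal [Z]-subset [S] of a [t]-subset [T] omits at most [n] elements of [T], and [T]
   is recovered from the pair [(S, T :\: S)]. *)
Lemma card_closed_subsets (I : finType) (A : {set I}) (Z : pred {set I}) (n t : nat) :
  (forall J K : {set I}, [disjoint J & K] -> Z J -> Z K -> Z (J :|: K)) -> Z set0 ->
  (forall B : {set I}, B \subset A -> n <= #|B| ->
     exists J : {set I}, [/\ J \subset B, J != set0 & Z J]) ->
  'C(#|A|, t) <=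
    #|[set S : {set I} | [&& S \subset A, Z S, t - n <= #|S| & #|S| <= t]]|
      * #|A|.+1 ^ n.
Proof.
move=> ZU Z0 Zex; set Y := [set S | _].
rewrite -cards_draws; set X := [set T | _].
set V := [set B : {set I} | (B \subset A) && (#|B| <= n)].
pose F (T : {set I}) := [arg max_(S > (set0 : {set I}) | (S \subset T) && Z S) #|S|].
have FP (T : {set I}) : T \subset A -> [/\ F T \subset T, Z (F T) & #|T :\: F T| <= n].
  move=> TA; rewrite /F; case: arg_maxnP => [|S /andP [ST ZS] Smax].
    by rewrite sub0set.
  split=> //; rewrite leqNgt; apply/negP => /ltnW nT.
  have [|J [sJ J0 ZJ]] := Zex _ _ nT; first by apply: subset_trans TA; apply: subsetDl.
  have dis : [disjoint S & J].
    rewrite disjoint_sym disjoint_subset; apply/subsetP => i /(subsetP sJ).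
    by rewrite !inE => /andP [].
  have /Smax : (S :|: J \subset T) && Z (S :|: J).
    rewrite ZU // andbT subUset ST /=; apply: (subset_trans sJ); exact: subsetDl.
  have := dis; rewrite -leq_card_setU => /eqP ->.
  by move: J0; rewrite -card_gt0; lia.
have inj : {in X &, injective (fun T : {set I} => (F T, T :\: F T))}.
  move=> T T'; rewrite !inE => /andP [/FP [sT _ _] _] /andP [/FP [sT' _ _] _] [E1 E2].
  by rewrite -(setID T (F T)) -(setID T' (F T')) (setIidPr sT) (setIidPr sT') E2 E1.
rewrite -(card_in_imset inj).
apply: (@leq_trans #|setX Y V|); last by rewrite cardsX leq_mul2l card_small_subsets orbT.
apply/subset_leq_card/subsetP => _ /imsetP [T] + ->.
rewrite !inE => /andP [TA /eqP <-]; have [sT ZT cT] := FP T TA.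
rewrite (subset_trans sT TA) ZT cT (subset_leq_card sT) /= !andbT.
rewrite (subset_trans (subsetDl _ _) TA) andbT.
by move: cT; rewrite cardsD (setIidPr sT); lia.
Qed.

(** * Carmichael numbers from subproducts *)

Lemma prime_dvd_prod (I : finType) (A : {set I}) (g : I -> nat) p :
  {in A, forall i, prime (g i)} -> prime p -> p %| \prod_(i in A) g i ->
  exists2 i, i \in A & p = g i.
Proof.
move=> gP pP; rewrite Euclid_dvd_prod // big_has_cond => /hasP [i _ /= /andP [iA]].
by rewrite dvdn_prime2 ?gP // => /eqP ->; exists i.
Qed.

Lemma prod_primes_inj (I : finType) (A : {set I}) (g : I -> nat) (S T : {set I}) :
  {in A, forall i, prime (g i)} -> {in A &, injective g} ->
  S \subset A -> T \subset A ->
  \prod_(i in S) g i = \prod_(i in T) g i -> S = T.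
Proof.
move=> gP ginj.
suff sub (S' T' : {set I}) : S' \subset A -> T' \subset A ->
    \prod_(i in S') g i = \prod_(i in T') g i -> S' \subset T'.
  by move=> SA TA E; apply/eqP; rewrite eqEsubset (sub _ _ SA TA E) (sub _ _ TA SA (esym E)).
move=> SA TA E; apply/subsetP => i iS.
have iA := subsetP SA i iS.
have: g i %| \prod_(i in T') g i by rewrite -E (bigD1 i) //= dvdn_mulr.
case/prime_dvd_prod; [|exact: gP|move=> j jT /ginj -> //].
  by move=> j jT; apply: gP; apply: (subsetP TA).
exact: (subsetP TA).
Qed.

Lemma coprime_prod (I : finType) (P : pred I) (g : I -> nat) a :
  (forall i, P i -> coprime a (g i)) -> coprime a (\prod_(i | P i) g i).
Proof.
move=> H; apply: (big_ind (fun b => coprime a b)) => //; first exact: coprimen1.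
by move=> b c; rewrite coprimeMr => -> ->.
Qed.

Lemma dvdn_prod_primes (I : finType) (A : {set I}) (g : I -> nat) M :
  {in A, forall i, prime (g i)} -> {in A &, injective g} ->
  {in A, forall i, g i %| M} -> \prod_(i in A) g i %| M.
Proof.
move=> gP ginj gM.
have: all (mem A) (enum A) by apply/allP => i; rewrite mem_enum.
rewrite -[X in X %| _]big_enum /=; have := enum_uniq (mem A).
elim: (enum _) => [|x r IH] /=; first by rewrite big_nil dvd1n.
move=> /andP [xr ur] /andP [xA rA]; rewrite big_cons Gauss_dvd ?IH ?gM //.
rewrite prime_coprime ?gP // Euclid_dvd_prod ?gP // big_has_cond.
apply/hasPn => i ir /=; have iA := allP rA _ ir.
rewrite dvdn_prime2 ?gP //; apply: contraNneq xr => /ginj -> //.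
Qed.

Lemma eqmod_prod_primes (I : finType) (A : {set I}) (g : I -> nat) a b :
  {in A, forall i, prime (g i)} -> {in A &, injective g} -> b <= a ->
  {in A, forall i, a = b %[mod g i]} -> a = b %[mod \prod_(i in A) g i].
Proof.
move=> gP ginj ba H; apply/eqP; rewrite eqn_mod_dvd //.
by apply: dvdn_prod_primes => // i iA; rewrite -eqn_mod_dvd //; apply/eqP/H.
Qed.

Lemma expn_mod_dvd_pred p k a :
  prime p -> p.-1 %| k -> coprime a p -> a ^ k = 1 %[mod p].
Proof.
move=> pP /dvdnP [j ->] cap; rewrite mulnC expnM -modnXm.
by rewrite -totient_prime // Euler_exp_totient // modnXm exp1n.
Qed.

(** The sufficient half of Korselt's criterion. Modulo a prime factor [p], either [p] divides [b] or
    Fermat gives [b ^ (N - 1) = 1]; the distinct prime moduli are then combined. *)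
Lemma korselt (I : finType) (A : {set I}) (g : I -> nat) :
  {in A, forall i, prime (g i)} -> {in A &, injective g} -> 1 < #|A| ->
  {in A, forall i, (g i).-1 %| (\prod_(i in A) g i).-1} ->
  carmichael (\prod_(i in A) g i).
Proof.
move=> gP ginj A2 Hd; set N := \prod_(i in A) g i.
have N0 : 0 < N by apply: prodn_cond_gt0 => i iA; apply: prime_gt0; exact: gP.
have Nb b : b ^ N = b %[mod N].
  apply: eqmod_prod_primes => //.
    by case: b => // b; rewrite -[X in X <= _]expn1 leq_pexp2l.
  move=> i iA; rewrite -(prednK N0) expnS -/N.
  have [d|cop] := boolP (g i %| b).
    by rewrite (eqP (dvdn_mulr _ d)) (eqP d).
  rewrite -modnMmr (@expn_mod_dvd_pred (g i)) ?gP // ?modnMmr ?muln1 //.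
    exact: Hd.
  by rewrite coprime_sym prime_coprime // gP.
split.
  have [i iA] : exists i, i \in A by apply/card_gt0P; apply: ltnW.
  have [j] : exists j, j \in A :\ i.
    by apply/card_gt0P; move: A2; rewrite (cardsD1 i) iA.
  rewrite !inE => /andP [ji jA].
  (* Two distinct indices exhibit a proper divisor of [N], so [N] is composite. *)
  have E : N = g i * (g j * \prod_(k in A | (k != i) && (k != j)) g k).
    rewrite /N (bigD1 i) //= (bigD1 j) /=; last by rewrite jA ji.
    by do 2 congr (_ * _); apply: eq_bigl => k; rewrite andbA.
  have gi1 := prime_gt1 (gP i iA); have gj1 := prime_gt1 (gP j jA).
  have r0 : 0 < \prod_(k in A | (k != i) && (k != j)) g k.
    by apply: prodn_cond_gt0 => k /andP [kA _]; apply: prime_gt0; exact: gP.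
  move: E; set r := \prod_(k in A | _) _ => E.
  have lt : g i < N.
    by rewrite E ltn_Pmulr ?prime_gt0 ?gP // (leq_trans gj1) // leq_pmulr.
  split; first exact: ltn_trans lt.
  apply/negP => NP; move: (dvdn_mulr (g j * r) (dvdnn (g i))).
  by rewrite -E dvdn_prime2 ?gP // => /eqP eN; rewrite -eN ltnn in lt.
move=> a.
have ZX b k : Z.of_nat (b ^ k) = Z.pow (Z.of_nat b) (Z.of_nat k).
  elim: k => [|k IH] //; rewrite expnS Nat2Z.inj_mul IH Nat2Z.inj_succ.
  by rewrite Z.pow_succ_r //; lia.
have NZ : Z.lt 0 (Z.of_nat N) by lia.
(* [carmichael] quantifies over all integers; the residue [b] of [a] brings the congruence back to
   natural numbers. *)
pose b := Z.to_nat (Z.modulo a (Z.of_nat N)).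
have bE : Z.of_nat b = (Z.modulo a (Z.of_nat N)).
  by rewrite Z2Nat.id //; apply: (proj1 (Z.mod_pos_bound _ _ NZ)).
have bN : b <= b ^ N.
  by case: b {bE} => // b; rewrite -[X in X <= _]expn1 leq_pexp2l.
move/eqP: (Nb b); rewrite eqn_mod_dvd // => /dvdnP [q Eq].
have EZ : Z.pow (Z.of_nat b) (Z.of_nat N) = Z.add (Z.mul (Z.of_nat q) (Z.of_nat N)) (Z.of_nat b).
  by rewrite -ZX -Nat2Z.inj_mul -Nat2Z.inj_add; congr Z.of_nat; move: Eq bN; lia.
apply: (proj1 (Z.mod_divide _ _ _)); first by lia.
rewrite Zminus_mod Zpower_mod // -bE EZ Z.add_comm Z_mod_plus_full.
by rewrite bE Zmod_mod Z.sub_diag.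
Qed.

(** * The semigroup of [inS], smooth exponents, and the assembly of Carmichael numbers *)

Lemma inS_mul a b : inS a -> inS b -> inS (a * b).
Proof.
move=> [a0 Ha] [b0 Hb]; split; first by rewrite muln_gt0 a0.
by move=> p pP; rewrite Euclid_dvdM // => /orP []; [apply: Ha|apply: Hb].
Qed.

Lemma inS_dvd a b : a %| b -> inS b -> inS a.
Proof.
move=> ab [b0 Hb]; split; first exact: dvdn_gt0 ab.
by move=> p pP pa; apply: Hb => //; apply: dvdn_trans ab.
Qed.

Lemma inS_prod (I : finType) (P : pred I) (g : I -> nat) :
  (forall i, P i -> inS (g i)) -> inS (\prod_(i | P i) g i).
Proof.
move=> H; apply: (big_ind inS) => //; last exact: inS_mul.
by split=> // p pP; rewrite dvdn1 => /eqP p1; rewrite p1 in pP.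
Qed.

Lemma inS_odd a : inS a -> odd a.
Proof.
move=> [a0 Ha]; apply: contraT => na; have := Ha 2 isT.
by rewrite dvdn2 na => /(_ isT).
Qed.

(** A common multiple of the [Y]-smooth numbers up to [Z]. The base [r] runs over all integers from
    2 to [Y], not only primes, which still leaves the product at most [Z ^ Y]. *)
Definition smooth_exponent (Y Z : nat) := \prod_(r < Y.+1 | 1 < r) r ^ trunc_log r Z.

Lemma smooth_exponent_gt0 Y Z : 0 < smooth_exponent Y Z.
Proof. by apply: prodn_cond_gt0 => r r1; rewrite expn_gt0 (ltnW r1). Qed.

Lemma smooth_exponent_le Y Z : 0 < Z -> smooth_exponent Y Z <= Z ^ Y.
Proof.
move=> Z0; apply: (@leq_trans (\prod_(r < Y.+1 | 1 < r) Z)).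
  by apply: leq_prod => r r1; apply: trunc_logP.
rewrite prod_nat_const leq_pexp2l // -ltnS -[X in _ < X](card_ord Y.+1).
by apply: proper_card; apply/properP; split; [apply/subsetP | exists ord0].
Qed.

Lemma dvdn_smooth_exponent Y Z a :
  0 < a <= Z -> (forall p, prime p -> p %| a -> p <= Y) ->
  a %| smooth_exponent Y Z.
Proof.
move=> /andP [a0 aZ] sm.
apply/dvdn_partP => // p; rewrite mem_primes => /and3P [pP _ pa].
rewrite p_part; have pY : p < Y.+1 by rewrite ltnS sm.
have p1 := prime_gt1 pP.
rewrite /smooth_exponent (bigD1 (Ordinal pY)) //= dvdn_mulr // dvdn_exp2l //.
apply: trunc_log_max => //; apply: leq_trans aZ; apply: dvdn_leq => //.
exact: pfactor_dvdnn.
Qed.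

(** The hypothesis on [n] combines the exponent bound [Z ^ Y] with [2 ^ (Z * Z.+1)], which exceeds
    the modulus. The condition [n.+2 <= t] leaves at least two primes in each product, and primes
    above [Z] cannot divide the modulus. *)
Lemma card_good_carmichael (Z Y kap n t Bd : nat) (Q : {set 'I_Z.+1})
    (R : {set {set 'I_Z.+1}}) :
  {in Q, forall q : 'I_Z.+1, [/\ prime q, inS q &
     forall p, prime p -> p %| q.-1 -> p <= Y]} ->
  inS kap ->
  {in R, forall U : {set 'I_Z.+1}, [/\ U \subset Q,
     {in Q, forall q : 'I_Z.+1, q %| kap -> q \in U},
     prime (2 * (\prod_(q in U) q) * kap + 1) &
     Z < 2 * (\prod_(q in U) q) * kap + 1 <= Bd]} ->
  0 < Z -> Z ^ Y * (Z * Z.+1) <= n -> n.+2 <= t ->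
  exists s : seq nat, [/\ uniq s,
    forall N, N \in s -> good_carmichael N /\ N <= Bd ^ t &
    'C(#|R|, t) <= size s * #|R|.+1 ^ n].
Proof.
move=> HQ kS HR Z0 Zn nt.
pose P (U : {set 'I_Z.+1}) := 2 * (\prod_(q in U) (q : nat)) * kap + 1.
have kap0 : 0 < kap by case: kS.
have QP : {in Q, forall q : 'I_Z.+1, prime q} by move=> q /HQ [].
have injQ : {in Q &, injective (fun q : 'I_Z.+1 => q : nat)}.
  by move=> q q' _ _; apply: val_inj.
have PP : {in R, forall U, prime (P U)} by move=> U /HR [].
have injP : {in R &, injective P}.
  move=> U V UR VR /eqP; rewrite /P eqn_add2r eqn_pmul2r // eqn_pmul2l // => /eqP E.
  have [UQ _ _ _] := HR U UR; have [VQ _ _ _] := HR V VR.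
  exact: prod_primes_inj QP injQ UQ VQ E.
(* The prime divisors of [kap] in [Q] all lie in each [U], so [A1] and [2 * kap * G] carry
   the whole of [P U - 1] in two coprime parts. *)
pose A1 := [set q in Q | ~~ ((q : nat) %| kap)].
pose A0 := [set q in Q | (q : nat) %| kap].
pose L := \prod_(q in A1) (q : nat); pose G := \prod_(q in A0) (q : nat).
have sA1 : A1 \subset Q by apply/subsetP => q; rewrite inE => /andP [].
have sA0 : A0 \subset Q by apply/subsetP => q; rewrite inE => /andP [].
have A1P : {in A1, forall q : 'I_Z.+1, prime q} by move=> q /(subsetP sA1); apply: QP.
have A0P : {in A0, forall q : 'I_Z.+1, prime q} by move=> q /(subsetP sA0); apply: QP.
have LG : \prod_(q in Q) (q : nat) = L * G.
  rewrite (bigID (fun q : 'I_Z.+1 => (q : nat) %| kap)) /= mulnC.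
  by congr (_ * _); apply: eq_bigl => q; rewrite !inE.
have L0 : 0 < L by apply: prodn_cond_gt0 => q /A1P /prime_gt0.
have copL : coprime (2 * kap * G) L.
  rewrite coprime_sym !coprimeMr -andbA; apply/and3P; split.
  - rewrite coprime_sym; apply: coprime_prod => q /(subsetP sA1) /HQ [_ /inS_odd + _].
    by rewrite coprime2n.
  - rewrite coprime_sym; apply: coprime_prod => q qA1; rewrite coprime_sym.
    by rewrite prime_coprime ?A1P //; move: qA1; rewrite inE => /andP [].
  - apply: coprime_prod => q qA0; rewrite coprime_sym; apply: coprime_prod => q' qA1.
    rewrite prime_coprime ?A0P // dvdn_prime2 ?(A0P q) ?(A1P q') //; apply/eqP => E.
    by move: qA0 qA1; rewrite !inE E => /andP [_ ->]; rewrite andbF.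
have copP : {in R, forall U, coprime (P U) L}.
  move=> U UR; have [_ _ _ /andP [ZP _]] := HR U UR.
  rewrite prime_coprime ?PP //; apply/negP => /(prime_dvd_prod A1P (PP U UR)) [q _ E].
  by move: ZP; rewrite -/(P U) E ltnNge -ltnS ltn_ord.
pose Zs := fun S : {set {set 'I_Z.+1}} => (\prod_(U in S) P U == 1 %[mod L]).
have ZsU (J K : {set {set 'I_Z.+1}}) : [disjoint J & K] -> Zs J -> Zs K -> Zs (J :|: K).
  move=> JK /eqP EJ /eqP EK; rewrite /Zs.
  rewrite (eq_bigl [predU J & K]) ?bigU //=; last by move=> U; rewrite !inE.
  by rewrite -modnMml EJ modnMml mul1n EK.
have Zs0 : Zs set0 by rewrite /Zs big_set0.
have expL a : coprime a L -> a ^ smooth_exponent Y Z = 1 %[mod L].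
  move=> ca; have [a0|a0] := posnP a.
    move: ca; rewrite a0 /coprime gcd0n => /eqP ->; by rewrite !modn1.
  apply: eqmod_prod_primes => //.
  - by move=> q q' /(subsetP sA1) qQ /(subsetP sA1) qQ'; apply: injQ.
  - by rewrite expn_gt0 a0.
  move=> q qA1; have [qP _ sm] := HQ q (subsetP sA1 q qA1).
  apply: expn_mod_dvd_pred => //.
    apply: dvdn_smooth_exponent => //; have := prime_gt1 qP; have := ltn_ord q; lia.
  by move: ca; rewrite /L (bigD1 q) //= coprimeMr => /andP [].
have Lk : L < 2 ^ (Z * Z.+1).
  rewrite expnM; apply: (@leq_ltn_trans (Z ^ Z.+1)).
    apply: (@leq_trans (\prod_(q in A1) Z)).
      by apply: leq_prod => q _; rewrite -ltnS ltn_ord.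
    rewrite prod_nat_const leq_pexp2l // -[X in _ <= X]card_ord; exact: max_card.
  by rewrite ltn_exp2r // ltn_expl.
have Zex (B : {set {set 'I_Z.+1}}) : B \subset R -> n <= #|B| ->
    exists J : {set {set 'I_Z.+1}}, [/\ J \subset B, J != set0 & Zs J].
  move=> BR nB.
  have copB : {in B, forall U, coprime (P U) L} by move=> U /(subsetP BR); apply: copP.
  have eB : smooth_exponent Y Z * (Z * Z.+1) <= #|B|.
    apply: leq_trans nB; apply: leq_trans Zn.
    by rewrite leq_mul2r smooth_exponent_le ?orbT.
  have [J' [JB J0' /eqP J1']] :=
    product_one_subset_mod L0 (smooth_exponent_gt0 Y Z) expL copB Lk eB.
  by exists J'.
have := @card_closed_subsets _ R Zs n t ZsU Zs0 Zex.
set F := [set S | _] => HF.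
pose N (S : {set {set 'I_Z.+1}}) := \prod_(U in S) P U.
(* Here [t - n >= 2] supplies the two prime factors that [korselt] asks for. *)
have FP (T : {set {set 'I_Z.+1}}) : T \in F -> [/\ T \subset R, Zs T, 1 < #|T| & #|T| <= t].
  by rewrite inE => /and4P [? ? H ?]; split=> //; move: H nt; lia.
exists [seq N T | T <- enum F]; split.
- rewrite map_inj_in_uniq ?enum_uniq // => T T'; rewrite !mem_enum.
  by move=> /FP [SR _ _ _] /FP [TR' _ _ _]; apply: prod_primes_inj PP injP SR TR'.
- move=> M /mapP [T]; rewrite mem_enum => /FP [SR ZS S1 St] ->.
  have SP : {in T, forall U, prime (P U)} by move=> U /(subsetP SR); apply: PP.
  have N0 : 0 < N T by apply: prodn_cond_gt0 => U /SP /prime_gt0.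
  have ZN : L %| (N T).-1 by rewrite -subn1 -eqn_mod_dvd.
  (* Every [U] contains [A0], so [G] divides its product and each [P U] is 1 modulo
     [2 * kap * G]. *)
  have kN : 2 * kap * G %| (N T).-1.
    rewrite -subn1 -eqn_mod_dvd //; apply/eqP.
    apply: (big_ind (fun x => x = 1 %[mod 2 * kap * G])) => //.
      by move=> x y Ex Ey; rewrite -modnMml Ex modnMml mul1n Ey.
    move=> U /(subsetP SR) UR; have [UQ kU _ _] := HR U UR.
    have GU : G %| \prod_(q in U) (q : nat).
      apply: dvdn_prod_primes => //; first by move=> ? ? _ _; apply: val_inj.
      by move=> q; rewrite inE => /andP [qQ qk]; rewrite (bigD1 q) ?kU //= dvdn_mulr.
    rewrite /P addnC; apply/eqP; rewrite eqn_mod_dvd ?leq_addr // addKn.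
    by rewrite -[2 * _ * kap]mulnAC dvdn_pmul2l // muln_gt0 kap0.
  have LGN : 2 * kap * G * L %| (N T).-1 by rewrite Gauss_dvd // kN ZN.
  split; last first.
    apply: (@leq_trans (\prod_(U in T) Bd)).
      by apply: leq_prod => U /(subsetP SR) /HR [_ _ _ /andP [_ +]].
    rewrite prod_nat_const; case: Bd HR => [|Bd] HR; last by rewrite leq_pexp2l.
    have [U US] : exists U, U \in T by apply/card_gt0P; apply: ltnW.
    by have [_ _ _ /andP [_]] := HR U (subsetP SR U US); rewrite addn1.
  split.
    apply: korselt => //; first by move=> U V /(subsetP SR) + /(subsetP SR) ; apply: injP.
    move=> U /(subsetP SR) UR; have [UQ _ _ _] := HR U UR.
    (* [P U - 1] is [2 * kap] times a product of distinct members of [Q], hence divides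
       [2 * kap * G * L]. *)
    apply: dvdn_trans LGN; rewrite -[2 * kap * G * L]mulnA [G * L]mulnC -LG.
    rewrite /P addn1 /= [2 * _ * kap]mulnAC.
    rewrite dvdn_pmul2l ?muln_gt0 ?kap0 //.
    apply: dvdn_prod_primes; first by move=> q /(subsetP UQ); apply: QP.
      by move=> ? ? _ _; apply: val_inj.
    by move=> q /(subsetP UQ) qQ; rewrite (bigD1 q) //= dvdn_mulr.
  move=> p pP /(prime_dvd_prod SP pP) [U /(subsetP SR) UR ->].
  have [UQ _ _ _] := HR U UR.
  rewrite /P addnK -mulnA mulKn //; apply: inS_mul => //.
  by apply: inS_prod => q /(subsetP UQ) /HQ [].
- by rewrite size_map -cardE.
Qed.

(** * Choosing the multiplier by pigeonhole *)

Local Open Scope R_scope.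

Lemma pbP (P : Prop) : reflect P (pb P).
Proof.
by rewrite /pb; case: ClassicalEpsilon.excluded_middle_informative => H; constructor.
Qed.

Definition nfloor (x : R) : nat := Z.to_nat (Int_part x).

Lemma nfloor_bounds x : 0 <= x -> INR (nfloor x) <= x < INR (nfloor x) + 1.
Proof.
move=> x0; have [H1 H2] := base_Int_part x.
have Z0 : Z.le 0 (Int_part x).
  have : IZR (-1) < IZR (Int_part x) by lra.
  by move/lt_IZR; lia.
by rewrite /nfloor INR_IZR_INZ Z2Nat.id //; lra.
Qed.

Lemma leRN m n : (m <= n)%N -> INR m <= INR n.
Proof. by move=> mn; apply: le_INR; lia. Qed.

Lemma ltRN m n : (m < n)%N -> INR m + 1 <= INR n.
Proof. by move/leRN; rewrite S_INR. Qed.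

Lemma leNR m n : INR m <= INR n -> (m <= n)%N.
Proof. by move/INR_le; lia. Qed.

Lemma leq_nfloor x n : 0 <= x -> INR n <= x -> (n <= nfloor x)%N.
Proof.
move=> x0 nx; have [_ H] := nfloor_bounds x0.
rewrite -ltnS; have : INR n < INR (nfloor x).+1 by rewrite S_INR; lra.
by move/INR_lt; lia.
Qed.

Lemma INR_pos n : (0 < n)%N -> 0 < INR n.
Proof. by move=> n0; apply: lt_0_INR; lia. Qed.

Lemma size_le_count X (P : nat -> Prop) (s : seq nat) :
  0 <= X -> uniq s ->
  (forall n, n \in s -> [/\ (0 < n)%N, INR n <= X & P n]) ->
  (size s <= count_le X P)%N.
Proof.
move=> X0 us H; rewrite /count_le -size_filter; apply: uniq_leq_size => // n ns.
have [n0 nX Pn] := H n ns.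
rewrite mem_filter mem_iota n0 add1n ltnS; apply/andP; split; first exact/pbP.
exact: leq_nfloor.
Qed.

Lemma count_as_sum (T : Type) (a : pred T) (s : seq T) :
  count a s = (\sum_(k <- s) a k)%N.
Proof. by rewrite -sum1_count big_mkcond; apply: eq_bigr => k _; case: (a k). Qed.

(* [k = q * k'] turns [2dk+1] into [2(dq)k'+1]; multiples [k] of a [q] dividing [d] are kept,
   because [d * q] is not squarefree and [inB] says nothing about it. *)
Lemma kappa_split (X : R) (d : nat) (s : seq nat) :
  0 <= X -> all (leq 1) s ->
  (kappa_sum X d <=
   count_le X (fun k => (inS k /\ prime (2 * d * k + 1)) /\
                 forall q, q \in s -> (q %| k)%N -> (q %| d)%N) +
   \sum_(q <- s | ~~ (q %| d)) kappa_sum (X / INR q) (d * q))%N.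
Proof.
move=> X0 s0; rewrite {1}/kappa_sum /count_le.
set K := iota _ _; set a := fun n => pb (inS n /\ _).
set b := fun n => pb (_ /\ forall q, _).
have step : (count a K <= count b K +
    \sum_(q <- s | ~~ (q %| d)) count (fun k => a k && (q %| k)) K)%N.
  rewrite (eq_bigr (fun q => \sum_(k <- K) (a k && (q %| k)))%N); last first.
    by move=> q _; rewrite count_as_sum.
  rewrite exchange_big /= !count_as_sum -big_split /=; apply: leq_sum => k _.
  case: (boolP (a k)) => //= ak.
  case: (boolP (b k)) => //= bk; rewrite add0n.
  have : has (fun q => ~~ (q %| d) && (q %| k))%N s.
    apply: contraR bk => /hasPn H; apply/pbP; split; first exact/pbP.
    by move=> q qs qk; apply: contraT => qd; move: (H q qs); rewrite qd qk.
  rewrite has_count -sum1_count -big_mkcondr /= => H; apply: (leq_trans H).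
  by rewrite [X in (_ <= X)%N](eq_bigl (fun q => ~~ (q %| d) && (q %| k))%N).
apply: (leq_trans step); rewrite leq_add2l big_seq_cond [X in (_ <= X)%N]big_seq_cond.
apply: leq_sum => q /andP [qs _]; have q0 := allP s0 q qs.
have Rq := INR_pos q0.
have Xq : 0 <= X / INR q by apply: Rdiv_le_0_compat.
rewrite -size_filter -(size_map (fun k => k %/ q)%N); apply: size_le_count => //.
  rewrite map_inj_in_uniq ?filter_uniq ?iota_uniq //.
  move=> k k'; rewrite !mem_filter => /andP [/andP [_ /divnK E] _].
  by move=> /andP [/andP [_ /divnK E'] _] H; rewrite -E -E' H.
move=> n /mapP [k]; rewrite mem_filter mem_iota => /andP [/andP [/pbP [kS kP] qk] /andP [k1 k2]] ->.
have E : (k %/ q * q = k)%N by apply: divnK.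
have kX : INR k <= X.
  have [H _] := nfloor_bounds X0; apply: Rle_trans H; apply: leRN.
  by move: k2; rewrite add1n ltnS.
split; first by rewrite divn_gt0 // dvdn_leq.
  rewrite -E mult_INR in kX; apply: (Rmult_le_reg_r (INR q)) => //.
  by rewrite /Rdiv Rmult_assoc Rinv_l ?Rmult_1_r //; lra.
split; first by apply: inS_dvd kS; rewrite -{2}E dvdn_mulr.
by rewrite -mulnA -[(d * q * _)%N]mulnA [(q * _)%N]mulnC E mulnA.
Qed.

Lemma sum_le_INR (s : seq nat) (a : pred nat) (f : nat -> nat) (b : R) :
  0 <= b -> (forall q, q \in s -> a q -> INR (f q) <= b) ->
  INR (\sum_(q <- s | a q) f q) <= INR (size s) * b.
Proof.
move=> b0; elim: s => [|q s IH] H; first by rewrite big_nil /=; lra.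
have {}IH := IH (fun q' qs => H q' (mem_behead (s := q :: s) qs)).
rewrite big_cons [size _]/= S_INR; case: ifP => aq; last by nra.
by rewrite plus_INR; have := H q (mem_head _ _) aq; lra.
Qed.

(** Double counting of the pairs [(U, k)]: if every [k] fell short, the total would be below
    [X * c * #|D|]. *)
Lemma pigeonhole_count (T : finType) (D : {set T}) (P : T -> nat -> Prop) X c :
  1 <= X -> (forall U, U \in D -> c * X <= INR (count_le X (P U))) ->
  exists k : nat, [/\ (0 < k)%N, INR k <= X &
    c * INR #|D| <= INR #|[set U in D | pb (P U k)]|].
Proof.
move=> X1 H; set K := nfloor X.
have X0 : 0 <= X by lra.
have [KX XK] := nfloor_bounds X0.
pose f k := #|[set U in D | pb (P U k)]|.
case: (boolP (has (fun k => pb (c * INR #|D| <= INR (f k))) (iota 1 K))).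
  case/hasP => k; rewrite mem_iota add1n ltnS => /andP [k1 kK] /pbP Hk.
  by exists k; split=> //; apply: Rle_trans KX; apply: leRN.
move/hasPn => N; exfalso.
have {}N k : k \in iota 1 K -> INR (f k) < c * INR #|D|.
  by move/N => /pbP; lra.
have E : (\sum_(U in D) count_le X (P U) = \sum_(k <- iota 1 K) f k)%N.
  rewrite (eq_bigr (fun U => \sum_(k <- iota 1 K) pb (P U k))%N); last first.
    by move=> U _; rewrite /count_le count_as_sum.
  rewrite exchange_big /=; apply: eq_bigr => k _.
  rewrite /f -sum1_card big_mkcond [RHS]big_mkcond /=; apply: eq_bigr => U _.
  by rewrite inE; case: (U \in D) => //=; case: (pb _).
have lo : INR #|D| * (c * X) <= INR (\sum_(U in D) count_le X (P U)).
  rewrite -big_enum /= cardE.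
  have : forall U, U \in enum D -> c * X <= INR (count_le X (P U)).
    by move=> U; rewrite mem_enum; apply: H.
  elim: (enum D) => [|U s IH] HU; first by rewrite big_nil /=; lra.
  rewrite big_cons [size _]/= S_INR plus_INR.
  have := HU U (mem_head _ _); have := IH (fun V Vs => HU V (mem_behead (s := U :: s) Vs)).
  by lra.
have hi : INR (\sum_(k <- iota 1 K) f k) < INR K * (c * INR #|D|).
  have K1 : (0 < size (iota 1 K))%N by rewrite size_iota; apply: leq_nfloor.
  rewrite -{2}(size_iota 1 K); elim: (iota 1 K) K1 N => // k s IH _ N.
  rewrite big_cons [size _]/= S_INR plus_INR.
  have := N k (mem_head _ _) ; case: s IH N => [|k' s] IH N.
    by rewrite big_nil /=; lra.
  have := IH isT (fun V Vs => N V (mem_behead (s := k :: k' :: s) Vs)).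
  by lra.
rewrite E in lo.
(* The sign of [c] is not given; positivity follows because the nonnegative count at [k = 1] lies
   below this product. *)
have b0 : 0 < c * INR #|D|.
  have K1 : (0 < K)%N by apply: leq_nfloor.
  have i1 : 1%N \in iota 1 K by rewrite mem_iota; lia.
  have := N 1%N i1; have := pos_INR (f 1%N); lra.
have := Rmult_le_compat_r _ _ _ (Rlt_le _ _ b0) KX; rewrite -/K; lra.
Qed.

(* The body of [inB] at a single [x]. *)
Definition kappa_bounds (c A A' B x : R) : Prop :=
  forall (d : nat) (y : R),
    inS d -> INR d <= Rpower x B * y ->
    squarefree d ->
    INR (max_pdiv d) <= Rpower x (B / log2 x) ->
    0 < y -> y <= Rpower x (B / log2 x) ->
    coprime d (ell c (Rpower x B)) ->
    let X := Rpower x (1 - B) / y in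
    let main := INR d * X / (INR (totient d) * ln (INR d * Rpower x (1 - B))) in
    / A * main <= sqrt (ln x) * INR (kappa_sum X d) /\
    sqrt (ln x) * INR (kappa_sum X d) <= A' * main.

(** * Sieving the multipliers [k] for a fixed [d] *)

Lemma INRM m n : INR (m * n)%N = INR m * INR n.
Proof. exact: mult_INR. Qed.

Lemma INRX a b : INR (a ^ b)%N = INR a ^ b.
Proof. by elim: b => // b IH; rewrite expnS INRM IH. Qed.

Lemma log2_ge1 x : 1 <= log2 x.
Proof. exact: Rmax_l. Qed.

Lemma Rpower_ge1 x a : 1 <= x -> 0 <= a -> 1 <= Rpower x a.
Proof. by move=> x1 a0; rewrite -(Rpower_O x); [apply: Rle_Rpower|lra]. Qed.

Lemma squarefree_mul_prime d q :
  squarefree d -> prime q -> ~~ (q %| d)%N -> squarefree (d * q).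
Proof.
move=> sd qP qd p pP; have [-> | /eqP pq] := eqVneq p q.
  by rewrite dvdn_pmul2r ?prime_gt0 // (negPf qd).
rewrite Gauss_dvdl; first exact: sd.
by rewrite coprimeMl !prime_coprime // !dvdn_prime2 //; case: eqP.
Qed.

Lemma max_pdiv_mul_prime d q :
  (0 < d)%N -> prime q -> (max_pdiv (d * q) <= maxn (max_pdiv d) q)%N.
Proof.
move=> d0 qP; have q0 := prime_gt0 qP; have q1 := prime_gt1 qP.
have dq : (1 < d * q)%N by rewrite (leq_trans q1) // leq_pmull.
have pP := max_pdiv_prime dq; have := max_pdiv_dvd (d * q).
rewrite Euclid_dvdM // => /orP [pd|]; last first.
  by rewrite dvdn_prime2 // => /eqP ->; rewrite leq_max leqnn orbT.
by rewrite leq_max max_pdiv_max // mem_primes pP d0 pd.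
Qed.

Lemma totient_le d : (totient d <= d)%N.
Proof.
rewrite totient_count_coprime -[X in (_ <= X)%N](subn0 d) -[X in (_ <= X)%N]muln1.
by rewrite -sum_nat_const_nat; apply: leq_sum => i _; apply: leq_b1.
Qed.

(** The [k] removed for one [q] cost at most [A' * main / w] (over [sqrt (ln x)]), because the
    totient gains a factor [q - 1 >= w]. By the last hypothesis all [q] together cost at most half
    of the lower bound for [d]. *)
Lemma good_kappa_lower (c A A' B x w : R) (d : nat) (qs : seq nat) :
  0 < A -> 0 < A' -> 0 < B < 1 -> 1 < x -> kappa_bounds c A A' B x ->
  inS d -> squarefree d -> INR d <= Rpower x B ->
  INR (max_pdiv d) <= Rpower x (B / log2 x) ->
  coprime d (ell c (Rpower x B)) ->
  (forall q, q \in qs -> [/\ prime q, inS q, INR q <= Rpower x (B / log2 x),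
     coprime q (ell c (Rpower x B)) & w <= INR q - 1]) ->
  0 < w -> INR (size qs) * (A' / w) <= / (2 * A) ->
  / (2 * A * (ln x * sqrt (ln x))) * Rpower x (1 - B) <=
  INR (count_le (Rpower x (1 - B)) (fun k => (inS k /\ prime (2 * d * k + 1)%N) /\
                 forall q, q \in qs -> (q %| k)%N -> (q %| d)%N)).
Proof.
move=> A0 A'0 [B0 B1] x1 HB dS sd dx dm dl Hq w0 Hw.
set X := Rpower x (1 - B); set G := count_le _ _.
have lx : 0 < ln x by rewrite -ln_1; apply: ln_increasing; lra.
have sx : 0 < sqrt (ln x) by apply: sqrt_lt_R0.
have X1 : 1 < X.
  have := @Rpower_lt x 0 (1 - B); rewrite Rpower_O; last lra.
  by rewrite -/X; apply; lra.
have d0 : (0 < d)%N by case: dS.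
have Rd : 1 <= INR d by have := ltRN d0; rewrite /=; lra.
have t0 : 0 < INR (totient d) by apply: INR_pos; rewrite totient_gt0.
have td : INR (totient d) <= INR d by apply: leRN; apply: totient_le.
have dX1 : 1 < INR d * X by nra.
have l0 : 0 < ln (INR d * X) by rewrite -ln_1; apply: ln_increasing; lra.
have lle : ln (INR d * X) <= ln x.
  apply: ln_le; first lra.
  have -> : x = Rpower x B * X.
    rewrite /X -Rpower_plus (_ : B + (1 - B) = 1); last by ring.
    by rewrite Rpower_1 //; lra.
  by apply: Rmult_le_compat_r; lra.
have pw : 1 <= Rpower x (B / log2 x).
  apply: Rpower_ge1; first lra.
  by apply: Rdiv_le_0_compat; [lra|have := log2_ge1 x; lra].
pose main := INR d * X / (INR (totient d) * ln (INR d * X)).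
have main0 : 0 < main by apply: Rdiv_lt_0_compat; nra.
(* The lower bound is taken at [y = 1]. *)
have lo : / A * main <= sqrt (ln x) * INR (kappa_sum X d).
  have := HB d 1 dS; rewrite Rmult_1_r !Rdiv_1_r -/X => /(_ dx sd dm Rlt_0_1 pw dl) [].
  by rewrite -/main.
(* With [y = q] the size condition on [d * q] reduces to that on [d], and the factor [q] cancels in
   the numerator of the main term. *)
have up q : q \in qs -> ~~ (q %| d)%N ->
    INR (kappa_sum (X / INR q) (d * q)) <= A' * (main / w) / sqrt (ln x).
  move=> /Hq [qP qS qx ql wq] qd.
  have q0 := INR_pos (prime_gt0 qP).
  have := HB (d * q)%N (INR q) (inS_mul dS qS).
  rewrite -/X mult_INR => H.
  have {H} := H (Rmult_le_compat_r _ _ _ (Rlt_le _ _ q0) dx) (squarefree_mul_prime sd qP qd).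
  have mx : INR (max_pdiv (d * q)) <= Rpower x (B / log2 x).
    apply: Rle_trans (leRN (max_pdiv_mul_prime d0 qP)) _.
    by rewrite /maxn; case: ifP.
  rewrite coprimeMl dl ql => /(_ mx q0 qx isT) [_ H].
  apply: (Rmult_le_reg_l (sqrt (ln x))) => //.
  apply: (Rle_trans _ _ _ H).
  have -> : sqrt (ln x) * (A' * (main / w) / sqrt (ln x)) = A' * (main / w).
    by field; lra.
  apply: Rmult_le_compat_l; first lra.
  rewrite totient_coprime; last by rewrite coprime_sym prime_coprime.
  rewrite (totient_prime qP) INRM.
  have -> : INR q.-1 = INR q - 1.
    by rewrite -[in RHS](prednK (prime_gt0 qP)) S_INR; lra.
  have q1 : 1 < INR q by have := ltRN (prime_gt1 qP); rewrite /=; lra.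
  have l1 : ln (INR d * X) <= ln (INR d * INR q * X).
    by apply: ln_le; [lra|nra].
  rewrite /main.
  have -> : INR d * INR q * (X / INR q) = INR d * X by field; lra.
  have -> : INR d * X / (INR (totient d) * ln (INR d * X)) / w =
     INR d * X * / (INR (totient d) * ln (INR d * X) * w) by field; lra.
  apply: Rmult_le_compat_l; first lra.
  apply: Rinv_le_contravar; first by apply: Rmult_lt_0_compat => //; nra.
  rewrite 2!(Rmult_assoc (INR (totient d))); apply: Rmult_le_compat_l; first lra.
  by rewrite (Rmult_comm _ w); apply: Rmult_le_compat; lra.
have X0 : 0 <= X by lra.
have q1 : all (leq 1) qs by apply/allP => q /Hq [/prime_gt0].
have := leRN (kappa_split d X0 q1); rewrite plus_INR -/G => HG.
have Hs : INR (\sum_(q <- qs | ~~ (q %| d)%N) kappa_sum (X / INR q) (d * q)) <=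
    INR (size qs) * (A' * (main / w) / sqrt (ln x)).
  apply: sum_le_INR => //.
  apply: Rdiv_le_0_compat => //; apply: Rmult_le_pos; first lra.
  by apply: Rdiv_le_0_compat; lra.
have E : INR (size qs) * (A' * (main / w) / sqrt (ln x)) <= / (2 * A) * main / sqrt (ln x).
  have -> : INR (size qs) * (A' * (main / w) / sqrt (ln x)) =
      (INR (size qs) * (A' / w)) * main / sqrt (ln x) by field; lra.
  apply: Rmult_le_compat_r; first by left; apply: Rinv_0_lt_compat.
  by apply: Rmult_le_compat_r; lra.
have lo' : / A * main / sqrt (ln x) <= INR (kappa_sum X d).
  apply: (Rmult_le_reg_l (sqrt (ln x))) => //.
  by have -> : sqrt (ln x) * (/ A * main / sqrt (ln x)) = / A * main by field; lra.
(* This removes [d] from the bound, by [totient d <= d] and [d * X <= x]. *)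
have mainX : X / ln x <= main.
  have -> : main = (INR d / INR (totient d)) * (X / ln (INR d * X)).
    by rewrite /main; field; lra.
  rewrite -[X in X <= _]Rmult_1_l; apply: Rmult_le_compat; try lra.
  - by apply: Rdiv_le_0_compat; lra.
  - by apply/Rle_div_r; lra.
  - by apply: Rmult_le_compat_l; [lra|apply: Rinv_le_contravar].
have : / (2 * A) * main / sqrt (ln x) <= INR G.
  have : / A * main / sqrt (ln x) = 2 * (/ (2 * A) * main / sqrt (ln x)) by field; lra.
  by lra.
apply: Rle_trans.
have -> : / (2 * A * (ln x * sqrt (ln x))) * X = / (2 * A) * (X / ln x) / sqrt (ln x).
  by field; lra.
apply: Rmult_le_compat_r; first by left; apply: Rinv_0_lt_compat.
by apply: Rmult_le_compat_l => //; left; apply: Rinv_0_lt_compat; lra.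
Qed.

(** * Primes: a Chebyshev bound and the choice of the moduli *)

(** Legendre's formula padded with zero terms, so that the factorials in a central binomial
    coefficient can be compared term by term. *)
Lemma logn_fact_widen p n N : prime p -> (n <= N)%N ->
  logn p n`! = (\sum_(1 <= k < N.+1) n %/ p ^ k)%N.
Proof.
move=> pP nN; rewrite logn_fact // (@big_cat_nat _ _ _ n.+1 1 N.+1) //=.
rewrite [X in (_ = _ + X)%N]big_nat_cond [X in (_ = _ + X)%N]big1 ?addn0 // => k.
rewrite andbT => /andP [nk _]; apply: divn_small.
by apply: leq_trans nk _; apply: ltnW; apply: ltn_expl; apply: prime_gt1.
Qed.

(** In Legendre's formula the floor of [2n / p ^ k] exceeds twice that of [n / p ^ k] by at most 1,
    and only when [p ^ k <= 2n]. So the exponent of [p] is at most [t]. *)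
Lemma pfactor_central_bin p n : prime p -> (0 < n)%N ->
  (p ^ logn p 'C(2 * n, n) <= 2 * n)%N.
Proof.
move=> pP n0; have p1 := prime_gt1 pP.
have n20 : (0 < 2 * n)%N by rewrite muln_gt0.
have nn : (n <= 2 * n)%N by rewrite leq_pmull.
have b0 : (0 < 'C(2 * n, n))%N by rewrite bin_gt0.
set t := trunc_log p (2 * n).
apply: (@leq_trans (p ^ t)); last exact: trunc_logP.
rewrite leq_exp2l //.
have := congr1 (logn p) (bin_fact nn).
have -> : (2 * n - n = n)%N by lia.
rewrite !lognM ?muln_gt0 ?fact_gt0 // !(logn_fact_widen pP nn) (logn_fact_widen pP (leqnn _)).
have : (\sum_(1 <= k < (2 * n).+1) (2 * n) %/ p ^ k <=
   \sum_(1 <= k < (2 * n).+1) (n %/ p ^ k + n %/ p ^ k) +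
   \sum_(1 <= k < (2 * n).+1) (k <= t))%N.
  rewrite -big_split /=; apply: leq_sum => k _.
  have q0 : (0 < p ^ k)%N by rewrite expn_gt0 ltnW.
  case: (leqP k t) => kt.
    rewrite -ltnS ltn_divLR //=.
    by have := ltn_ceil n q0; move: (n %/ p ^ k)%N (p ^ k)%N => a q; lia.
  rewrite divn_small ?leq0n //; apply: leq_trans (trunc_log_ltn _ p1) _.
  by rewrite leq_exp2l.
rewrite big_split /=.
have : (\sum_(1 <= k < (2 * n).+1) (k <= t) <= t)%N.
  have -> : (\sum_(1 <= k < (2 * n).+1) (k <= t) = count (fun k => k <= t) (index_iota 1 (2 * n).+1))%N.
    by rewrite count_as_sum.
  rewrite -size_filter -[X in (_ <= X)%N](size_iota 1).
  apply: uniq_leq_size; first by rewrite filter_uniq // iota_uniq.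
  by move=> k; rewrite mem_filter mem_index_iota mem_iota; lia.
lia.
Qed.

(** By Pascal's rule and symmetry, [C(2n+2, n+1) = 2 C(2n+1, n) >= 2 C(2n, n)]. *)
Lemma central_bin_ge n : (2 ^ n <= 'C(2 * n, n))%N.
Proof.
elim: n => // n IH; rewrite expnS.
have -> : (2 * n.+1 = (2 * n).+2)%N by lia.
rewrite binS; apply: (@leq_trans (2 * 'C((2 * n).+1, n))).
  rewrite leq_mul2l /=; apply: leq_trans IH _.
  by case: n => // n; rewrite [in X in (_ <= X)%N]binS leq_addr.
rewrite mul2n -addnn leq_add2r.
have -> : 'C((2 * n).+1, n.+1) = 'C((2 * n).+1, n) by rewrite -bin_sub; [congr binomial|]; lia.
by [].
Qed.

(** The central binomial coefficient is a product of prime powers, each at most [2n], over distinct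
    primes up to [2n]. *)
Lemma chebyshev_lower n : (0 < n)%N ->
  (2 ^ n <= (2 * n) ^ prime_pi (INR (2 * n)))%N.
Proof.
move=> n0; apply: leq_trans (central_bin_ge n) _.
have b0 : (0 < 'C(2 * n, n))%N by rewrite bin_gt0 leq_pmull.
rewrite {1}(_ : 'C(2 * n, n) = \prod_(p <- primes 'C(2 * n, n)) p ^ logn p 'C(2 * n, n))%N; last first.
  by rewrite [LHS]prod_prime_decomp // prime_decompE big_map.
apply: (@leq_trans (\prod_(p <- primes 'C(2 * n, n)) (2 * n))%N).
  rewrite big_seq [X in (_ <= X)%N]big_seq; apply: leq_prod => p.
  by rewrite mem_primes => /and3P [pP _ _]; apply: pfactor_central_bin.
rewrite big_const_seq count_predT iter_muln_1 leq_pexp2l ?muln_gt0 //.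
apply: size_le_count; [exact: pos_INR|exact: primes_uniq|].
move=> p; rewrite mem_primes => /and3P [pP _ pb]; split; rewrite ?prime_gt0 //.
apply: leRN.
have : (p %| (2 * n)`!)%N.
  by rewrite -(@bin_fact (2 * n) n) ?dvdn_mulr // leq_pmull.
elim: (2 * n)%N => [|m IH]; first by rewrite fact0 dvdn1 => /eqP p1; rewrite p1 in pP.
rewrite factS Euclid_dvdM // => /orP [/dvdn_leq ->|/IH] //; exact: leqW.
Qed.

Lemma count_le_mono x y P : 0 <= x <= y -> (count_le x P <= count_le y P)%N.
Proof.
move=> [x0 xy]; rewrite /count_le -/(nfloor x) -/(nfloor y).
have H : (nfloor x <= nfloor y)%N.
  by apply: leq_nfloor; [lra|have := nfloor_bounds x0; lra].
by rewrite -(subnKC H) iotaD count_cat leq_addr.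
Qed.

Lemma prime_pi_lower z : 4 <= z -> z * ln 2 / (4 * ln z) <= INR (prime_pi z).
Proof.
(* Since [z >= 4], this [n] is at least [z / 4], whence the constant 4. *)
move=> z4; set n := nfloor (z / 2).
have [n1 n2] : INR n <= z / 2 < INR n + 1 by apply: nfloor_bounds; lra.
have n0 : (0 < n)%N by apply: leq_nfloor; rewrite /=; lra.
have lz : 0 < ln z by rewrite -ln_1; apply: ln_increasing; lra.
have R2n : INR (2 * n) = 2 * INR n by rewrite INRM.
have Rn := INR_pos n0.
have := leRN (chebyshev_lower n0); rewrite !INRX => H.
have := @ln_le _ _ _ H; rewrite !ln_pow ?R2n; try (rewrite /=; lra).
have -> : INR 2 = 2 by [].
move=> /(_ (pow_lt _ _ Rlt_0_2)) H2.
have l2 : 0 < ln 2 by rewrite -ln_1; apply: ln_increasing; lra.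
have l3 : ln (2 * INR n) <= ln z by apply: ln_le; lra.
have mono : INR (prime_pi (2 * INR n)) <= INR (prime_pi z).
  by apply: leRN; apply: count_le_mono; lra.
apply/Rle_div_l; first lra.
have := pos_INR (prime_pi (2 * INR n)).
have l4 : 0 <= ln (2 * INR n).
  by rewrite -ln_1; apply: ln_le; [lra|have := leRN n0; rewrite /=; lra].
nra.
Qed.

(** By excluded middle some value satisfies [is_ell], so [epsilon] returns one; it is either an
    exceptional modulus, bounded by [T], or 1. *)
Lemma ell_bounds c T : 1 <= T -> (0 < ell c T)%N /\ INR (ell c T) <= T.
Proof.
move=> T1; have : is_ell c T (ell c T).
  apply: epsilon_spec.
  have [[l [chi H]]|H] := classic (exists l chi, exceptional c T l chi).
    by exists l; left; exists chi.
  by exists 1%N; right.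
case=> [[chi [_ [[[l0 _] _] [lT _]]]]|[-> _]]; first by [].
by split=> //=; lra.
Qed.

(** Each prime divisor contributes a factor of at least 2. Thus avoiding the exceptional modulus
    excludes only logarithmically many primes. *)
Lemma size_primes_ln l : (0 < l)%N -> INR (size (primes l)) * ln 2 <= ln (INR l).
Proof.
move=> l0; have H : (2 ^ size (primes l) <= l)%N.
  rewrite [X in (_ <= X)%N]prod_prime_decomp // prime_decompE big_map /=.
  have -> : (2 ^ size (primes l) = \prod_(p <- primes l) 2)%N.
    by rewrite big_const_seq count_predT iter_muln_1.
  rewrite big_seq [X in (_ <= X)%N]big_seq; apply: leq_prod => p pl.
  have := pl; rewrite mem_primes => /and3P [pP _ _].
  apply: leq_trans (prime_gt1 pP) _; rewrite -[X in (X <= _)%N]expn1.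
  by apply: leq_pexp2l; [exact: prime_gt0|rewrite logn_gt0].
have := leRN H; rewrite INRX => H'.
have E : INR 2 = 2 by [].
rewrite E in H'.
by rewrite -ln_pow; [apply: ln_le => //; apply: pow_lt; lra|lra].
Qed.

(** From the primes counted by [pi2], those up to [w] and those dividing [l] are discarded; exactly
    [M] of the rest are kept, so that later counts are binomial coefficients. *)
Lemma select_moduli (z y w : R) (l M : nat) :
  0 <= z -> 0 <= w -> (0 < l)%N ->
  (M + nfloor w + size (primes l) <= pi2 z y)%N ->
  exists Q : {set 'I_(nfloor z).+1}, #|Q| = M /\
    forall q : 'I_(nfloor z).+1, q \in Q ->
      [/\ prime q, inS q, INR (max_pdiv (q - 1)) <= y, coprime q l & w < INR q].
Proof.
move=> z0 w0 l0; set Z := nfloor z; rewrite /pi2 /count_le -/(nfloor z) -/Z.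
set a := fun n => pb _; move=> Ha.
pose b n := [&& a n, ~~ (n \in primes l) & ~~ (n <= nfloor w)%N].
have cnt : (count a (iota 1 Z) <= count b (iota 1 Z) + nfloor w + size (primes l))%N.
  have H1 : (count (mem (primes l)) (iota 1 Z) <= size (primes l))%N.
    rewrite -size_filter; apply: uniq_leq_size; first by rewrite filter_uniq ?iota_uniq.
    by move=> n; rewrite mem_filter => /andP [].
  have H2 : (count (fun n => n <= nfloor w)%N (iota 1 Z) <= nfloor w)%N.
    rewrite -size_filter -[X in (_ <= X)%N](size_iota 1).
    apply: uniq_leq_size; first by rewrite filter_uniq ?iota_uniq.
    by move=> n; rewrite mem_filter !mem_iota; lia.
  apply: (@leq_trans (count b (iota 1 Z) + count (fun n => n <= nfloor w)%N (iota 1 Z) + count (mem (primes l)) (iota 1 Z))); last by lia.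
  rewrite !count_as_sum -!big_split /=; apply: leq_sum => n _; rewrite /b.
  by case: (a n) => //=; case: (n \in primes l); case: (n <= nfloor w)%N.
pose F := [set q : 'I_Z.+1 | (0 < q)%N && b q].
have MF : (M <= #|F|)%N.
  apply: (@leq_trans (count b (iota 1 Z))); first by lia.
  rewrite -size_filter cardE -(size_map val); apply: uniq_leq_size.
    by rewrite filter_uniq ?iota_uniq.
  move=> n; rewrite mem_filter mem_iota add1n => /andP [bn /andP [n0 nZ]].
  by apply/mapP; exists (Ordinal nZ) => //; rewrite mem_enum inE /= n0 bn.
have [Q] : exists Q, Q \in [set A : {set 'I_Z.+1} | A \subset F & #|A| == M].
  by apply/card_gt0P; rewrite cards_draws bin_gt0.
rewrite inE => /andP [QF /eqP QM]; exists Q; split=> // q /(subsetP QF).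
rewrite inE => /andP [q0 /and3P [/pbP [qP [qS qy]] ql qw]]; split=> //.
  rewrite prime_coprime //; apply: contra ql => ql.
  by rewrite mem_primes qP l0 ql.
rewrite -ltnNge in qw; apply: Rnot_le_lt => H.
by move: qw; rewrite ltnNge leq_nfloor.
Qed.

(** * The count for given parameters *)

Lemma exp_mono a b : a <= b -> exp a <= exp b.
Proof. by case=> [H|->]; [left; apply: exp_increasing|right]. Qed.

Lemma INR_gt0 n : 0 < INR n -> (0 < n)%N.
Proof. by case: n => //=; lra. Qed.

(** Induction through [(t+1) C(r+1, t+1) = (r+1) C(r, t)], using [(r+1) / (t+1) <= r / t] for
    [t <= r]. *)
Lemma bin_lower r t : (t <= r)%N -> (r ^ t <= 'C(r, t) * t ^ t)%N.
Proof.
elim: t r => [|t IH] [|r] // tr.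
rewrite expnS [(t.+1 ^ _)%N]expnS mulnA [('C(_, _) * _)%N]mulnC -mul_bin_diag -mulnA leq_mul2l /=.
case: t IH tr => [|t] IH tr; first by rewrite bin0.
have t0 : (0 < t.+1 ^ t.+1)%N by rewrite expn_gt0.
rewrite -(leq_pmul2r t0) -expnMn.
apply: (@leq_trans ((t.+2 * r) ^ t.+1)%N); first by rewrite leq_exp2r //; lia.
by rewrite expnMn [('C(_, _) * _)%N]mulnC -mulnA leq_mul2l IH // orbT.
Qed.

Lemma bin_upper r t : ('C(r, t) <= r ^ t)%N.
Proof.
apply: (@leq_trans (r ^_ t)); first by rewrite -bin_ffact leq_pmulr // fact_gt0.
elim: t r => // t IH [|r]; first by rewrite ffact0n exp0n.
rewrite ffactSS expnS leq_mul //; apply: (leq_trans (IH r)).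
by case: t {IH} => // t; rewrite leq_exp2r.
Qed.

Lemma ln_bin_lower r t : (0 < t <= r)%N ->
  INR t * (ln (INR r) - ln (INR t)) <= ln (INR 'C(r, t)).
Proof.
move=> /andP [t0 tr]; have Rt := INR_pos t0.
have Rr := INR_pos (leq_trans t0 tr).
have b0 : (0 < 'C(r, t))%N by rewrite bin_gt0.
have := leRN (bin_lower tr); rewrite INRM !INRX => H.
have := ln_le _ _ (pow_lt _ _ Rr) H; rewrite ln_mult ?ln_pow //; first lra.
  exact: INR_pos.
exact: pow_lt.
Qed.

Lemma prod_le_expn (T : finType) (U : {set T}) (f : T -> nat) z :
  (forall q, q \in U -> f q <= z)%N -> (\prod_(q in U) f q <= z ^ #|U|)%N.
Proof. by move=> H; rewrite -prod_nat_const; apply: leq_prod. Qed.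

(** All non-asymptotic steps together. [Q] has [M] elements, each [d] is a product of [u] of them,
    [rho] bounds from below the logarithm of the number [r] of primes found, and each Carmichael
    number has at most [t] prime factors. *)
Lemma carmichael_family_bound (c A A' B x z y w rho X : R) (M u n t : nat) :
  0 < A -> 0 < A' -> 0 < B < 1 -> 1 < x -> kappa_bounds c A A' B x ->
  4 <= z -> z <= Rpower x (B / log2 x) ->
  1 < w -> z <= w * w -> INR M * (A' / (w - 1)) <= / (2 * A) ->
  (M + nfloor w + size (primes (ell c (Rpower x B))) <= pi2 z y)%N ->
  INR M <= z -> (2 <= u <= M)%N -> INR u * ln z <= B * ln x ->
  (nfloor z ^ nfloor y * (nfloor z * (nfloor z).+1) <= n)%N -> (n.+2 <= t)%N ->
  INR t * ln (3 * x) <= ln X -> 0 < X -> 0 <= y ->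
  rho <= INR u * (ln (INR M) - ln (INR u)) - ln (2 * A * (ln x * sqrt (ln x))) ->
  ln (INR t) <= rho ->
  0 < INR (Ccount X) /\
  INR t * (rho - ln (INR t)) - INR n * ln (3 * x) <= ln (INR (Ccount X)).
Proof.
move=> A0 A'0 [B0 B1] x1 HB z4 zx w1 zw HM Hpi Mz /andP [u2 uM] ux nZ nt tX X0 y0 Hrho Ht.
have lx : 0 < ln x by rewrite -ln_1; apply: ln_increasing; lra.
have sx : 0 < sqrt (ln x) by apply: sqrt_lt_R0.
have xB1 : 1 <= Rpower x B by apply: Rpower_ge1; lra.
have [l0 _] := ell_bounds c xB1.
set l := ell c _ in Hpi l0.
have z0 : 0 <= z by lra.
have [|Q [QM HQ]] := @select_moduli z y w l M z0 _ l0 Hpi; first lra.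
set Z := nfloor z in Q QM HQ nZ *.
have [Zz zZ] := nfloor_bounds z0; rewrite -/Z in Zz zZ.
have QP : {in Q, forall q : 'I_Z.+1, prime q} by move=> q /HQ [].
have qZ (q : 'I_Z.+1) : (q <= Z)%N by rewrite -ltnS.
have zux : z ^ u <= Rpower x B.
  rewrite -Rpower_pow; last lra.
  by rewrite /Rpower; apply: exp_mono; lra.
pose D := [set U : {set 'I_Z.+1} | (U \subset Q) && (#|U| == u)].
have DC : #|D| = 'C(M, u) by rewrite cards_draws QM.
pose X1 := Rpower x (1 - B).
have X11 : 1 <= X1 by apply: Rpower_ge1; lra.
pose qs : seq nat := [seq val q | q <- enum Q].
have qsP q : q \in qs -> exists2 q' : 'I_Z.+1, q' \in Q & q = q'.
  by case/mapP => q'; rewrite mem_enum => qQ ->; exists q'.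
pose d (U : {set 'I_Z.+1}) := (\prod_(q in U) (q : nat))%N.
pose P U k := (inS k /\ prime (2 * d U * k + 1)%N) /\
  forall q, q \in qs -> (q %| k)%N -> (q %| d U)%N.
have UP (U : {set 'I_Z.+1}) : U \subset Q -> {in U, forall q : 'I_Z.+1, prime q}.
  by move=> UQ q /(subsetP UQ); apply: QP.
have dx U : U \in D -> INR (d U) <= Rpower x B.
  rewrite inE => /andP [UQ /eqP Uu]; apply: Rle_trans zux.
  apply: (Rle_trans _ (INR (Z ^ u))).
    by apply: leRN; rewrite -Uu; apply: prod_le_expn.
  by rewrite INRX; apply: pow_incr; split=> //; apply: pos_INR.
(* Two factors above [w] already give more than [w * w >= z]. This puts [2 * d U * k + 1] above
   every element of [Q]. *)
have dw U : U \in D -> INR (d U) > z.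
  rewrite inE => /andP [UQ /eqP Uu].
  apply: (Rle_lt_trans _ (w ^ 2)); first by rewrite /=; lra.
  have [q [q' [qU q'U qq']]] : exists q q', [/\ q \in U, q' \in U & q != q'].
    by apply/card_gt1P; rewrite Uu.
  have E : (d U = q * (q' * \prod_(k in U | (k != q) && (k != q')) (k : nat)))%N.
    rewrite /d (bigD1 q) //= (bigD1 q') /=; last by rewrite q'U eq_sym.
    by do 2 congr (_ * _)%N; apply: eq_bigl => k; rewrite andbA.
  have r0 : (0 < \prod_(k in U | (k != q) && (k != q')) (k : nat))%N.
    by apply: prodn_cond_gt0 => k /andP [/(UP U UQ) /prime_gt0].
  have [_ _ _ _ wq] := HQ q (subsetP UQ q qU).
  have [_ _ _ _ wq'] := HQ q' (subsetP UQ q' q'U).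
  rewrite E !INRM; have := leRN r0; rewrite [INR 1]/= => r1.
  have : w * w < INR q * INR q' by nra.
  have : 0 < INR q * INR q' by nra.
  rewrite /= Rmult_1_r -Rmult_assoc.
  by move: (INR q * INR q') (INR (\prod_(_ in _ | _) _)) r1 => a b; nra.
pose c0 := / (2 * A * (ln x * sqrt (ln x))).
have P0 : 0 < 2 * A * (ln x * sqrt (ln x)).
  by apply: Rmult_lt_0_compat; [lra|exact: Rmult_lt_0_compat].
have c00 : 0 < c0 by apply: Rinv_0_lt_compat.
have Plow U : U \in D -> c0 * X1 <= INR (count_le X1 (P U)).
  move=> UD; have := UD; rewrite inE => /andP [UQ /eqP Uu].
  have inQ q : q \in U -> q \in Q by apply: (subsetP UQ).
  apply: (@good_kappa_lower c A A' B x (w - 1)) => //.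
  - by apply: inS_prod => q /inQ /HQ [].
  - move=> p pP ppd; have [q qU pq] : exists2 q, q \in U & p = (q : 'I_Z.+1).
      by apply: (prime_dvd_prod (UP U UQ) pP); apply: dvdn_trans ppd; apply: dvdn_mulr.
    move: ppd; rewrite /d (bigD1 q) //= -pq dvdn_pmul2l ?prime_gt0 //.
    rewrite Euclid_dvd_prod // big_has_cond => /hasP [q' _ /= /andP [/andP [q'U q'q]]].
    rewrite dvdn_prime2 // ?(UP U UQ q') // pq => /eqP E.
    by move/eqP: q'q; apply; apply: val_inj.
  - exact: dx.
  - have d1 : (1 < d U)%N.
      have : INR 1 < INR (d U) by have := dw U UD; rewrite /=; lra.
      by move/INR_lt; lia.
    have [q qU ->] := prime_dvd_prod (UP U UQ) (max_pdiv_prime d1) (max_pdiv_dvd _).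
    by apply: Rle_trans zx; apply: Rle_trans Zz; apply: leRN.
  - rewrite coprime_sym; apply: coprime_prod => q /inQ /HQ [_ _ _ + _].
    by rewrite coprime_sym.
  - move=> q /qsP [q' /HQ [qP qS _ ql wq] ->]; split=> //; last lra.
    by apply: Rle_trans zx; apply: Rle_trans Zz; apply: leRN.
  - lra.
  - by rewrite size_map -cardE QM.
have [k [k0 kX Hk]] := pigeonhole_count X11 Plow.
set R0 := [set U in D | _] in Hk.
pose r := #|R0|.
(* A crude bound that lets [ln (r + 1)] be replaced by [ln (3 * x)] in the final loss. *)
have Rx : INR r <= x.
  apply: (Rle_trans _ (INR #|D|)).
    by apply: leRN; apply: subset_leq_card; apply/subsetP => U; rewrite inE => /andP [].
  rewrite DC; apply: (Rle_trans _ (INR (M ^ u))); first by apply: leRN; apply: bin_upper.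
  rewrite INRX; apply: (Rle_trans _ (z ^ u)).
    by apply: pow_incr; split=> //; apply: pos_INR.
  apply: Rle_trans zux _; rewrite -[X in _ <= X](Rpower_1 x); last lra.
  by apply: Rle_Rpower; lra.
have kS : inS k.
  have : 0 < INR r.
    apply: Rlt_le_trans Hk; apply: Rmult_lt_0_compat => //.
    by rewrite DC; apply: INR_pos; rewrite bin_gt0.
  move/INR_gt0.
  by case/card_gt0P => U; rewrite inE => /andP [_ /pbP [[]]].
(* The pigeonhole gives [r >= c0 * C(M, u)], and [C(M, u)] is at least [(M / u) ^ u]. *)
have Rlow : rho <= ln (INR r).
  have Rr : c0 * INR 'C(M, u) <= INR r by rewrite -DC.
  have b0 : 0 < INR 'C(M, u) by apply: INR_pos; rewrite bin_gt0.
  have := ln_le _ _ (Rmult_lt_0_compat _ _ c00 b0) Rr.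
  rewrite ln_mult // /c0 ln_Rinv //.
  have := @ln_bin_lower M u; rewrite uM (leq_trans _ u2) // => /(_ isT).
  lra.
have t0 : (0 < t)%N by apply: leq_trans nt.
have r_pos : 0 < INR r.
  apply: Rlt_le_trans Hk; apply: Rmult_lt_0_compat => //.
  by rewrite DC; apply: INR_pos; rewrite bin_gt0.
have tr : (t <= r)%N.
  apply: leNR; apply: Rnot_lt_le => H.
  by have := ln_increasing _ _ r_pos H; lra.
have HQ' : {in Q, forall q : 'I_Z.+1, [/\ prime q, inS q &
     forall p, prime p -> p %| q.-1 -> p <= nfloor y]%N}.
  move=> q /HQ [qP qS qy _ _]; split=> // p pP pq; apply: leq_nfloor => //.
  apply: Rle_trans qy; apply: leRN; rewrite subn1; apply: max_pdiv_max.
  rewrite mem_primes pP pq andbT /=; have := prime_gt1 qP; have := inS_odd qS.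
  by case: (nat_of_ord q) => [|[|]].
have HR : {in R0, forall U : {set 'I_Z.+1}, [/\ U \subset Q,
     {in Q, forall q : 'I_Z.+1, q %| k -> q \in U},
     prime (2 * (\prod_(q in U) q) * k + 1) &
     Z < 2 * (\prod_(q in U) q) * k + 1 <= nfloor (3 * x)]%N}.
  move=> U; rewrite inE => /andP [UD /pbP [[_ pU] kU]].
  have := UD; rewrite inE => /andP [UQ _]; split=> //.
    move=> q qQ qk; have : (q %| d U)%N.
      by apply: kU => //; apply/mapP; exists q; rewrite ?mem_enum.
    case/(prime_dvd_prod (UP U UQ) (QP q qQ)) => q' q'U E.
    by rewrite (_ : q = q') //; apply: val_inj.
  rewrite -/(d U); apply/andP; split.
    have : (Z <= d U)%N by apply: leNR; have := dw U UD; lra.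
    have : (d U <= d U * k)%N by rewrite leq_pmulr.
    by rewrite -mulnA; lia.
  (* [d U <= x ^ B] and [k <= x ^ (1 - B)] give [2 * d U * k + 1 <= 2 * x + 1 <= 3 * x]. *)
  apply: leq_nfloor; first lra.
  rewrite plus_INR !INRM [INR 2]/= [INR 1]/=.
  have E : Rpower x B * X1 = x.
    rewrite /X1 -Rpower_plus (_ : B + (1 - B) = 1); last by ring.
    by rewrite Rpower_1 //; lra.
  have : INR (d U) * INR k <= x.
    by rewrite -E; apply: Rmult_le_compat => //; [exact: pos_INR|exact: pos_INR|exact: dx].
  lra.
have Z0 : (0 < Z)%N by apply: leq_nfloor; rewrite /=; lra.
have [s [us Hs Hc]] := card_good_carmichael HQ' kS HR Z0 nZ nt.
have sC : (size s <= Ccount X)%N.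
  apply: size_le_count => //; first lra.
  move=> N /Hs [gN NB]; split=> //.
    by case: gN => [[[/ltnW]]].
  apply: (Rle_trans _ (INR (nfloor (3 * x) ^ t))); first exact: leRN.
  have [Bx _] : INR (nfloor (3 * x)) <= 3 * x < INR (nfloor (3 * x)) + 1.
    by apply: nfloor_bounds; lra.
  rewrite INRX; apply: (Rle_trans _ ((3 * x) ^ t)).
    by apply: pow_incr; split=> //; apply: pos_INR.
  rewrite -Rpower_pow; last lra.
  rewrite /Rpower -[X in _ <= X](exp_ln X) //; exact: exp_mono.
have C0 : (0 < 'C(r, t))%N by rewrite bin_gt0.
have Hc' : ('C(r, t) <= Ccount X * r.+1 ^ n)%N.
  by apply: leq_trans Hc _; rewrite leq_mul2r sC orbT.
have CX : (0 < Ccount X)%N by case: (Ccount X) Hc' C0 => //; rewrite mul0n; case: binomial.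
have RC := INR_pos CX; split=> //.
have := ln_le _ _ (INR_pos C0) (leRN Hc').
have r1 : 0 < INR r.+1 by apply: INR_pos.
rewrite INRM INRX ln_mult ?ln_pow //; last exact: pow_lt.
have := @ln_bin_lower r t; rewrite t0 tr => /(_ isT).
have : ln (INR r.+1) <= ln (3 * x) by apply: ln_le => //; rewrite S_INR; lra.
have := pos_INR n; have Rt := INR_pos t0.
move=> Rn H1 H2 H3.
have : INR n * ln (INR r.+1) <= INR n * ln (3 * x) by apply: Rmult_le_compat_l.
have : INR t * rho <= INR t * ln (INR r) by apply: Rmult_le_compat_l; lra.
lra.
Qed.

(** * Asymptotics *)

Definition eventually (P : R -> Prop) : Prop :=
  exists W0, forall W, W0 <= W -> P W.

Lemma eventually_and P Q :
  eventually P -> eventually Q -> eventually (fun W => P W /\ Q W).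
Proof.
move=> [a Ha] [b Hb]; exists (Rmax a b) => W HW; split.
  by apply: Ha; apply: Rle_trans HW; apply: Rmax_l.
by apply: Hb; apply: Rle_trans HW; apply: Rmax_r.
Qed.

Lemma eventually_ge K : eventually (fun W => K <= W).
Proof. by exists K. Qed.

Lemma ln_lt_self v : 0 < v -> ln v <= v.
Proof.
by move=> v0; have := exp_ineq1_le (ln v); rewrite exp_ln //; lra.
Qed.

(** Write [W ^ a] as [v * v] with [v = W ^ (a / 2)]: one factor dominates [1 + ln W] up to a
    constant, the other absorbs the constants. *)
Lemma eventually_ln_le_Rpower K a : 0 <= K -> 0 < a ->
  eventually (fun W => K * (1 + ln W) <= Rpower W a).
Proof.
move=> K0 a0; set V := K * (1 + 2 / a) + 1.
have V1 : 1 <= V.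
  have : 0 <= 2 / a by apply: Rdiv_le_0_compat; lra.
  by rewrite /V; nra.
exists (exp (2 / a * ln V)) => W HW.
have W0 : 0 < W by have := exp_pos (2 / a * ln V); lra.
have lW : 2 / a * ln V <= ln W.
  by rewrite -[X in X <= _]ln_exp; apply: ln_le => //; apply: exp_pos.
pose v := Rpower W (a / 2).
have vv : Rpower W a = v * v by rewrite /v -Rpower_plus; congr Rpower; field.
have vV : V <= v.
  rewrite -(exp_ln V); last lra.
  rewrite /v /Rpower; apply: exp_mono.
  have -> : ln V = a / 2 * (2 / a * ln V) by field; lra.
  by apply: Rmult_le_compat_l; lra.
have v0 : 0 < v by apply: exp_pos.
have H : a / 2 * ln W <= v.
  by have := ln_lt_self v0; rewrite {1}/v /Rpower ln_exp.
have H' : ln W <= 2 / a * v.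
  have -> : ln W = 2 / a * (a / 2 * ln W) by field; lra.
  by apply: Rmult_le_compat_l => //; apply: Rdiv_le_0_compat; lra.
rewrite vv; have : K * (1 + 2 / a) * v <= v * v by apply: Rmult_le_compat_r; rewrite /V in vV; lra.
have : K * (1 + ln W) <= K * (v + 2 / a * v) by apply: Rmult_le_compat_l; lra.
lra.
Qed.

Lemma log2_exp l : 1 <= l -> 1 <= ln l -> log2 (exp l) = ln l.
Proof. by move=> l1 ll; rewrite /log2 /log1 ln_exp !Rmax_right. Qed.

(** Everything rests on [tau * (1 - E) = 1 - d]. The fourth inequality compares the exponent of
    [M / u] with [tau * E]; its loss [7 * d] is [eps / 12], whence the 84. *)
Lemma param_facts (B E eps d tau c1 : R) :
  0 < B < 1 -> 0 < E < 1 -> 0 < eps -> eps <= E * B -> d = eps / 84 ->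
  tau = (1 - d) / (1 - E) -> c1 = E * B - eps / 3 ->
  [/\ 0 < d <= / 84, 1 - d <= tau,
  1 + d <= tau * (1 - 3 * d),
  tau * (E - 7 * d) <= tau * (1 - 3 * d) - (1 + d) &
  0 < c1 <= 1].
Proof.
move=> B01 E01 eps0 epsEB dE tauE c1E.
have EB1 : E * B <= 1 by nra.
have EB0 : 0 < E * B by nra.
have d0 : 0 < d <= / 84 by rewrite dE; lra.
have EBE : E * B <= E by nra.
have tE : tau * (1 - E) = 1 - d by rewrite tauE; field; lra.
have t1 : 1 - d <= tau.
  by apply: (Rmult_le_reg_r (1 - E)); [lra|rewrite tE; nra].
have key : tau * (E - 7 * d) <= tau * (1 - 3 * d) - (1 + d).
  have : 1 + d <= tau * (1 - E + 4 * d); last lra.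
  by rewrite Rmult_plus_distr_l tE; nra.
split=> //; last by rewrite c1E; lra.
have : 0 <= tau * (E - 7 * d); last lra.
by apply: Rmult_le_pos; lra.
Qed.

(** The demands on [W], in order: the thresholds [x2] and [x1], enough primes in [Q],
    [z <= x ^ (B / log2 x)], [u >= 2], the error in [rho], [W] small against [ln x],
    [n <= exp (W / 2)], and [t] large. Each follows from a bound [k * (1 + ln W) <= W ^ a]. *)
Lemma eventually_growth (A A' B E eps x1 gam x2 d tau c1 : R) :
  0 < A -> 0 < A' -> 0 < B < 1 -> 0 < E < 1 -> 0 < eps -> eps <= E * B ->
  0 < gam -> d = eps / 84 -> tau = (1 - d) / (1 - E) -> c1 = E * B - eps / 3 ->
  eventually (fun W => 3 <= W /\
    Rabs x2 + 1 <= Rpower W (1 + d) /\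
    Rabs x1 + 4 <= Rpower W tau /\
    2 + 4 * A * A' + 16 * tau / (gam * ln 2) * ln W <= Rpower W (tau * d) /\
    tau * (1 + d) * (ln W * ln W) <= B * Rpower W (1 + d) /\
    3 * (tau * ln W) <= B * Rpower W (1 + d) /\
    tau * ln W + Rabs (ln (2 * A)) + 3 / 2 * (1 + d) * ln W <=
      eps / 4 * Rpower W (1 + d) /\
    18 / eps + 1 / c1 <= Rpower W d /\
    8 * tau * ln W <= Rpower W d /\
    (8 / eps + 8) * (Rpower W (1 + d) + 2) <= exp (W / 2)).
Proof.
move=> A0 A'0 B01 E01 eps0 epsEB gam0 dE tauE c1E.
have [d0 t1 t2 t3 c10] := param_facts B01 E01 eps0 epsEB dE tauE c1E.
have tau0 : 0 < tau by lra.
have l2 : 0 < ln 2 by rewrite -ln_1; apply: ln_increasing; lra.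
have gl : 0 < gam * ln 2 by apply: Rmult_lt_0_compat.
have ge0 k W : 3 <= W -> 0 <= k -> k <= k * (1 + ln W) /\ k * ln W <= k * (1 + ln W).
  move=> W3 k0; have : 0 <= ln W by rewrite -ln_1; apply: ln_le; lra.
  by nra.
have big k a (P : R -> Prop) : 0 <= k -> 0 < a ->
   (forall W, 3 <= W -> k * (1 + ln W) <= Rpower W a -> 0 < ln W -> P W) -> eventually P.
  move=> k0 a0 H.
  have [W0 HW0] := eventually_and (eventually_ge 3) (eventually_ln_le_Rpower k0 a0).
  exists W0 => W /HW0 [W3 HW]; apply: H => //.
  by rewrite -ln_1; apply: ln_increasing; lra.
apply: eventually_and; first exact: eventually_ge.
apply: eventually_and.
  apply: (big (Rabs x2 + 1) (1 + d)) => [||W W3 H _]; try lra.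
    by have := Rabs_pos x2; lra.
  have := @ge0 (Rabs x2 + 1) W W3; have := Rabs_pos x2; lra.
apply: eventually_and.
  apply: (big (Rabs x1 + 4) tau) => [||W W3 H _]; try lra.
    by have := Rabs_pos x1; lra.
  have := @ge0 (Rabs x1 + 4) W W3; have := Rabs_pos x1; lra.
have AA : 0 < A * A' by apply: Rmult_lt_0_compat.
apply: eventually_and.
  have k0 : 0 <= 16 * tau / (gam * ln 2) by apply: Rdiv_le_0_compat; lra.
  apply: (big (2 + 4 * A * A' + 16 * tau / (gam * ln 2)) (tau * d)) => [||W W3 H L0].
  - lra.
  - by apply: Rmult_lt_0_compat; lra.
  - by move: (16 * tau / (gam * ln 2)) k0 H => k k0; nra.
apply: eventually_and.
  have k0 : 0 <= tau * (1 + d) / B by apply: Rdiv_le_0_compat; nra.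
  apply: (big (1 + tau * (1 + d) / B) ((1 + d) / 2)) => [||W W3 H L0]; try lra.
  (* The left side is quadratic in [ln W], so each half of the power pays for one factor. *)
  have -> : Rpower W (1 + d) = Rpower W ((1 + d) / 2) * Rpower W ((1 + d) / 2).
    by rewrite -Rpower_plus; congr Rpower; field.
  have -> : tau * (1 + d) * (ln W * ln W) = B * (tau * (1 + d) / B * (ln W * ln W)).
    by field; lra.
  apply: Rmult_le_compat_l; first lra.
  move: (tau * (1 + d) / B) k0 H => k k0 H.
  apply: (Rle_trans _ ((1 + k) * (1 + ln W) * ((1 + k) * (1 + ln W)))).
    have : k * (ln W * ln W) <= (1 + k) * (ln W * ln W) by nra.
    have : (1 + k) * (ln W * ln W) <= (1 + k) * ((1 + k) * (ln W * ln W)).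
      by have : 0 <= (1 + k) * (ln W * ln W); nra.
    have : (1 + k) * ln W <= (1 + k) * (1 + ln W) by nra.
    have : 0 <= (1 + k) * ln W by nra.
    by nra.
  by apply: Rmult_le_compat => //; nra.
apply: eventually_and.
  have k0 : 0 <= 3 * tau / B by apply: Rdiv_le_0_compat; lra.
  apply: (big (3 * tau / B) (1 + d)) => [||W W3 H L0]; try lra.
  have -> : 3 * (tau * ln W) = B * (3 * tau / B * ln W) by field; lra.
  apply: Rmult_le_compat_l; first lra.
  by have := @ge0 (3 * tau / B) W W3; lra.
apply: eventually_and.
  pose k := tau + Rabs (ln (2 * A)) + 3 / 2 * (1 + d).
  have k0 : 0 <= k by rewrite /k; have := Rabs_pos (ln (2 * A)); lra.
  have k1 : 0 <= k / (eps / 4) by apply: Rdiv_le_0_compat; lra.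
  apply: (big (k / (eps / 4)) (1 + d)) => [||W W3 H L0]; try lra.
  have : k * (1 + ln W) <= eps / 4 * Rpower W (1 + d).
    have -> : k * (1 + ln W) = eps / 4 * (k / (eps / 4) * (1 + ln W)) by field; lra.
    by apply: Rmult_le_compat_l; lra.
  rewrite /k; have := Rabs_pos (ln (2 * A)); nra.
apply: eventually_and.
  have k0 : 0 <= 18 / eps by apply: Rdiv_le_0_compat; lra.
  have k1 : 0 <= 1 / c1 by apply: Rdiv_le_0_compat; lra.
  apply: (big (18 / eps + 1 / c1) d) => [||W W3 H L0]; try lra.
  by have := @ge0 (18 / eps + 1 / c1) W W3; lra.
apply: eventually_and.
  by apply: (big (8 * tau) d) => [||W W3 H L0]; lra.
pose k := 3 * (8 / eps + 8).
have e8 : 0 <= 8 / eps by apply: Rdiv_le_0_compat; lra.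
have k0 : 0 < k by rewrite /k; lra.
apply: (big (2 * (Rabs (ln k) + (1 + d))) 1) => [||W W3 H L0]; try lra.
  by have := Rabs_pos (ln k); lra.
rewrite Rpower_1 in H; last lra.
have l1 : 1 <= Rpower W (1 + d) by apply: Rpower_ge1; lra.
apply: (Rle_trans _ (k * Rpower W (1 + d))).
  by rewrite /k; nra.
rewrite -{1}(exp_ln k) // /Rpower -exp_plus; apply: exp_mono.
have := Rle_abs (ln k); have := Rabs_pos (ln k); nra.
Qed.

Lemma Ccount_lower (c A A' B E eps x1 gam x2 : R) :
  0 < A -> 0 < A' -> 0 < B < 1 -> 0 < E < 1 -> 0 < eps -> eps <= E * B -> 0 < gam ->
  (forall x, x1 <= x ->
    INR (pi2 x (Rpower x (1 - E))) >= gam * INR (prime_pi x)) ->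
  (forall x, x2 <= x -> kappa_bounds c A A' B x) ->
  eventually (fun W =>
    exp ((E * B - eps) * exp W) <= INR (Ccount (exp (exp W)))).
Proof.
move=> A0 A'0 B01 E01 eps0 epsEB gam0 HE HB.
pose d := eps / 84; have dE : d = eps / 84 by [].
pose tau := (1 - d) / (1 - E); have tauE : tau = (1 - d) / (1 - E) by [].
pose c1 := E * B - eps / 3; have c1E : c1 = E * B - eps / 3 by [].
have [d0 t1 t2 t3 [c10 c11]] := param_facts B01 E01 eps0 epsEB dE tauE c1E.
have [W0 HW0] := eventually_growth x1 x2 A0 A'0 B01 E01 eps0 epsEB gam0 dE tauE c1E; exists W0 => W /HW0.
set lam := Rpower W (1 + d); set D := Rpower W (tau * d).
move=> [W3 [g1 [g2 [g3 [g4 [g5 [g6 [g7 [g8 g9]]]]]]]]].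
have L0 : 1 <= ln W.
  rewrite -[X in X <= _]ln_exp; apply: ln_le; first exact: exp_pos.
  by have := exp_le_3; lra.
set L := ln W in g3 g4 g5 g6 g8 L0.
have l2 : / 2 < ln 2 := ln_lt_2.
have AA : 0 < A * A' by apply: Rmult_lt_0_compat.
have gl : 0 < gam * ln 2 by apply: Rmult_lt_0_compat; lra.
have k0 : 0 <= 16 * tau / (gam * ln 2) by apply: Rdiv_le_0_compat; lra.
have kL : 0 <= 16 * tau / (gam * ln 2) * L by apply: Rmult_le_pos; lra.
have D2 : 2 <= D by lra.
have D4 : 4 * (A * A') <= D by lra.
have DL : 16 * (tau * L) <= gam * ln 2 * D.
  have -> : 16 * (tau * L) = gam * ln 2 * (16 * tau / (gam * ln 2) * L).
    by field; lra.
  by apply: Rmult_le_compat_l; lra.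
have eps1 : 0 < 18 / eps by apply: Rdiv_lt_0_compat; lra.
have c1i : 0 < 1 / c1 by apply: Rdiv_lt_0_compat; lra.
pose z := Rpower W tau; pose Z1 := Rpower W (tau * (1 - 3 * d)).
have lamE : lam = W * Rpower W d by rewrite /lam Rpower_plus Rpower_1 //; lra.
have Wlam : 18 / eps * W + 1 / c1 * W <= lam by rewrite lamE; nra.
have Weps : 18 * W <= eps * lam.
  have -> : 18 * W = eps * (18 / eps * W) by field; lra.
  by apply: Rmult_le_compat_l; [lra|nra].
have Wc1 : W <= c1 * lam.
  have -> : W = c1 * (1 / c1 * W) by field; lra.
  by apply: Rmult_le_compat_l; [lra|nra].
have W_lam : W <= lam by nra.
have lamZ : lam <= Z1 by apply: Rle_Rpower; lra.
have Z11 : 3 <= Z1 by lra.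
have zE : z = Z1 * D * D * D.
  by rewrite /z /Z1 /D -!Rpower_plus; congr Rpower; ring.
have lnz : ln z = tau * L by rewrite /z /Rpower ln_exp.
have lnZ1 : ln Z1 = tau * (1 - 3 * d) * L by rewrite /Z1 /Rpower ln_exp.
pose x := exp lam.
have lnx : ln x = lam by rewrite /x ln_exp.
have lx : 1 + lam <= x by apply: exp_ineq1_le.
have l2x : log2 x = (1 + d) * L.
  have lnlam : ln lam = (1 + d) * L by rewrite /lam /Rpower ln_exp.
  by rewrite /x log2_exp ?lnlam //; nra.
pose w := Z1 * D * D; pose M := nfloor (Z1 * D).
have ZD2 : Z1 * 2 <= Z1 * D by apply: Rmult_le_compat_l; lra.
have ZD : 6 <= Z1 * D by lra.
have wD2 : Z1 * D * 2 <= w by apply: Rmult_le_compat_l; lra.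
have wD : 12 <= w by lra.
have [M1 M2] : INR M <= Z1 * D < INR M + 1 by apply: nfloor_bounds; lra.
have zw : z = w * D by rewrite zE /w.
have zD2 : w * 2 <= z by rewrite zw; apply: Rmult_le_compat_l; lra.
have zge : 24 <= z by lra.
have MZ1 : Z1 <= INR M by lra.
have tL : 0 < tau * L by apply: Rmult_lt_0_compat; lra.
(* The largest number of factors up to [z] whose product is sure to stay within [x ^ B]. *)
pose u := nfloor (B * lam / (tau * L)).
have q0 : 0 <= B * lam / (tau * L).
  by apply: Rdiv_le_0_compat => //; apply: Rmult_le_pos; lra.
have [u1 u2] := nfloor_bounds q0; rewrite -/u in u1 u2.
have qE : B * lam / (tau * L) * (tau * L) = B * lam by field; lra.
have uL : INR u * (tau * L) <= B * lam.
  by rewrite -qE; apply: Rmult_le_compat_r; lra.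
have uL' : B * lam <= INR u * (tau * L) + tau * L.
  rewrite -qE; have : B * lam / (tau * L) * (tau * L) <= (INR u + 1) * (tau * L).
    by apply: Rmult_le_compat_r; lra.
  lra.
have u_2 : (2 <= u)%N.
  apply: leNR; rewrite [INR 2]/=; apply: Rnot_lt_le => H.
  have : (INR u + 1) * (tau * L) < 3 * (tau * L) by apply: Rmult_lt_compat_r; lra.
  lra.
have [Ru1] : INR u <= lam /\ 0 < INR u.
  split; last by apply: INR_pos; apply: leq_trans u_2.
  have tL1 : 1 <= tau * L.
    rewrite -lnz -[X in X <= _]ln_exp; apply: ln_le; first exact: exp_pos.
    by have := exp_le_3; lra.
  apply: (Rle_trans _ _ _ u1); apply/Rle_div_l; first lra.
  have : B * lam <= 1 * lam by apply: Rmult_le_compat_r; lra.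
  have : lam * 1 <= lam * (tau * L) by apply: Rmult_le_compat_l; lra.
  lra.
move=> Ru0.
have uM : (u <= M)%N by apply: leNR; lra.
pose y := Rpower z (1 - E).
have yE : y = Rpower W (1 - d).
  rewrite /y /z Rpower_mult; congr Rpower; rewrite /tau; field; lra.
have yW : y * Rpower W d = W.
  by rewrite yE -Rpower_plus (_ : 1 - d + d = 1) ?Rpower_1 //; lra.
have y1 : 1 <= y by rewrite yE; apply: Rpower_ge1; lra.
pose n := (nfloor z ^ nfloor y * (nfloor z * (nfloor z).+1))%N.
pose v := exp (W / 2).
have vv : exp W = v * v by rewrite /v -exp_plus; congr exp; field.
have zp : 0 <= z by lra.
have [Z_1 _] := nfloor_bounds zp.
have [Y_1 _] : INR (nfloor y) <= y < INR (nfloor y) + 1 by apply: nfloor_bounds; lra.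
(* [n <= z ^ (y + 3)] and [y + 3 <= 4 * y]; with [8 * tau * L <= W ^ d] and [y * W ^ d = W] the
   exponent is at most [W / 2]. *)
have Rn : INR n <= v.
  rewrite /n !INRM INRX S_INR.
  apply: (Rle_trans _ (Rpower z y * Rpower z 3)).
    apply: Rmult_le_compat.
    - by apply: pow_le; apply: pos_INR.
    - by apply: Rmult_le_pos; have := pos_INR (nfloor z); lra.
    - apply: (Rle_trans _ (z ^ nfloor y)).
        by apply: pow_incr; split=> //; apply: pos_INR.
      by rewrite -Rpower_pow; [apply: Rle_Rpower|]; lra.
    - have -> : Rpower z 3 = z * (z * z).
        rewrite (_ : 3 = INR 3); last by rewrite /=; lra.
        by rewrite Rpower_pow /=; [ring|lra].
      apply: Rmult_le_compat; [exact: pos_INR| |lra|].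
        by have := pos_INR (nfloor z); lra.
      have : 24 * z <= z * z by apply: Rmult_le_compat_r; lra.
      lra.
  rewrite -Rpower_plus {1}/Rpower lnz; apply: exp_mono.
  have : 1 * (tau * L) <= y * (tau * L) by apply: Rmult_le_compat_r; lra.
  have : y * (8 * tau * L) <= y * Rpower W d by apply: Rmult_le_compat_l; lra.
  lra.
(* [lam + 2] bounds [ln (3 * x)], so [(3 * x) ^ t] stays below [exp (exp W)]. *)
pose t := nfloor (exp W / (lam + 2)).
have lam3 : ln (3 * x) <= lam + 2.
  rewrite ln_mult ?lnx; [|lra|lra].
  have : ln 3 <= ln (exp 2) by apply: ln_le; [lra|have := exp_ineq1_le 2; lra].
  by rewrite ln_exp; lra.
have lnx3 : 0 < ln (3 * x) by rewrite -ln_1; apply: ln_increasing; lra.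
have v0 : 0 < v by apply: exp_pos.
have e8 : 0 < 8 / eps by apply: Rdiv_lt_0_compat; lra.
rewrite -/v Rmult_plus_distr_r in g9.
have le8 : 0 <= 8 / eps * (lam + 2) by apply: Rmult_le_pos; lra.
have v8 : 8 * (lam + 2) <= v by lra.
have veps : 8 * (lam + 2) <= eps * v.
  have -> : 8 * (lam + 2) = eps * (8 / eps * (lam + 2)) by field; lra.
  by apply: Rmult_le_compat_l; lra.
have T0 : 0 <= exp W / (lam + 2) by apply: Rdiv_le_0_compat; [have := exp_pos W|]; lra.
have [T1 T2] := nfloor_bounds T0; rewrite -/t in T1 T2.
have TE : exp W / (lam + 2) * (lam + 2) = exp W by field; lra.
have Tv : 8 * v <= exp W / (lam + 2).
  apply: (Rmult_le_reg_r (lam + 2)); first lra.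
  by rewrite TE vv; have := Rmult_le_compat_l _ _ _ (Rlt_le _ _ v0) v8; lra.
have tn : (n.+2 <= t)%N.
  by apply: leNR; rewrite !S_INR; lra.
have Rt : 0 < INR t by apply: INR_pos; apply: leq_trans tn.
have lnt : ln (INR t) <= W.
  rewrite -[X in _ <= X]ln_exp; apply: ln_le => //.
  apply: (Rle_trans _ _ _ T1); apply/Rle_div_l; first lra.
  rewrite -[X in X <= _]Rmult_1_r.
  by apply: Rmult_le_compat_l; [left; apply: exp_pos|lra].
have [] := @carmichael_family_bound c A A' B x z y w (c1 * lam) (exp (exp W)) M u n t
  A0 A'0 B01.
- lra.
- apply: HB; have := Rle_abs x2; lra.
- lra.
- rewrite l2x /Rpower lnx -[X in X <= _](exp_ln z); last lra.
  apply: exp_mono; rewrite lnz.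
  have -> : B / ((1 + d) * L) * lam = B * lam / ((1 + d) * L) by field; lra.
  have dL : 0 < (1 + d) * L by apply: Rmult_lt_0_compat; lra.
  have -> : tau * L = tau * (1 + d) * (L * L) / ((1 + d) * L) by field; lra.
  by apply: Rmult_le_compat_r => //; left; apply: Rinv_0_lt_compat.
- lra.
- have DD : 1 * D <= Z1 * D * D by apply: Rmult_le_compat_r; lra.
  by rewrite zw; apply: Rmult_le_compat_l; rewrite /w; lra.
- have -> : INR M * (A' / (w - 1)) = INR M * A' / (w - 1) by field; lra.
  apply/Rle_div_l; first lra.
  have A2 : 0 < / (2 * A) by apply: Rinv_0_lt_compat; lra.
  have D' : A' <= / (2 * A) * (D / 2).
    have -> : A' = / (2 * A) * (4 * (A * A') / 2) by field; lra.
    by apply: Rmult_le_compat_l; lra.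
  apply: (Rle_trans _ (/ (2 * A) * (w / 2))); last by apply: Rmult_le_compat_l; lra.
  have -> : / (2 * A) * (w / 2) = Z1 * D * (/ (2 * A) * (D / 2)) by rewrite /w; field; lra.
  by apply: Rmult_le_compat => //; [exact: pos_INR|lra].
- have xB1 : 1 <= Rpower x B by apply: Rpower_ge1; lra.
  have [l0 lB] := ell_bounds c xB1.
  have := size_primes_ln l0.
  have := ln_le _ _ (INR_pos l0) lB.
  have -> : ln (Rpower x B) = B * lam by rewrite /Rpower ln_exp lnx.
  set s := size _ => H1 H2.
  have s2 : INR s <= 2 * Z1.
    have : INR s * / 2 <= INR s * ln 2 by apply: Rmult_le_compat_l; [exact: pos_INR|lra].
    have : B * lam <= 1 * lam by apply: Rmult_le_compat_r; lra.
    lra.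
  have [w1 _] : INR (nfloor w) <= w < INR (nfloor w) + 1 by apply: nfloor_bounds; lra.
  have zx1 : x1 <= z by have := Rle_abs x1; rewrite /z; lra.
  have z4 : 4 <= z by lra.
  have HEz := HE _ zx1; rewrite -/y in HEz.
  have := prime_pi_lower z4; rewrite lnz => Hpi.
  have pi2z : gam * (z * ln 2 / (4 * (tau * L))) <= INR (pi2 z y).
    have : gam * (z * ln 2 / (4 * (tau * L))) <= gam * INR (prime_pi z).
      by apply: Rmult_le_compat_l; lra.
    lra.
  apply: leNR; apply: Rle_trans pi2z; rewrite !plus_INR.
  have -> : gam * (z * ln 2 / (4 * (tau * L))) = w * (gam * ln 2 * D / (4 * (tau * L))).
    by rewrite zw; field; lra.
  (* Thus [pi2 z y >= 4 * w], while [M], [nfloor w] and the number of excluded primes are each at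
     most [w]. *)
  have : 4 <= gam * ln 2 * D / (4 * (tau * L)).
    apply: (Rmult_le_reg_r (4 * (tau * L))); first lra.
    have -> : gam * ln 2 * D / (4 * (tau * L)) * (4 * (tau * L)) = gam * ln 2 * D.
      by field; lra.
    lra.
  move: (gam * ln 2 * D / _) => q q4.
  have := Rmult_le_compat_l w _ _ _ q4; lra.
- lra.
- by rewrite u_2 uM.
- by rewrite lnz lnx.
- by [].
- exact: tn.
- rewrite ln_exp -[X in _ <= X]TE.
  by apply: Rmult_le_compat; lra.
- exact: exp_pos.
- lra.
(* The loss [eps / 3] in [c1] is [eps / 12] from [7 * d] plus [eps / 4] for the rounding of [u] and
   the logarithm of [2 * A * lam ^ (3/2)]. *)
- have lnlam : ln lam = (1 + d) * L by rewrite /lam /Rpower ln_exp.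
  have lam0 : 0 < lam by lra.
  have ss : ln (sqrt lam) = ln lam / 2.
    by rewrite -Rpower_sqrt // /Rpower ln_exp; field.
  have s0 : 0 < sqrt lam by apply: sqrt_lt_R0.
  have -> : ln (2 * A * (ln x * sqrt (ln x))) = ln (2 * A) + (3 / 2) * ((1 + d) * L).
    rewrite lnx ln_mult; [|lra|exact: Rmult_lt_0_compat].
    by rewrite (ln_mult lam) // ss lnlam; field.
  have lM : tau * (1 - 3 * d) * L <= ln (INR M).
    by rewrite -lnZ1; apply: ln_le; lra.
  have lu : ln (INR u) <= (1 + d) * L by rewrite -lnlam; apply: ln_le.
  have dif : (E - 7 * d) * (tau * L) <= ln (INR M) - ln (INR u).
    have : tau * (E - 7 * d) * L <= (tau * (1 - 3 * d) - (1 + d)) * L.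
      by apply: Rmult_le_compat_r; lra.
    lra.
  have udif := Rmult_le_compat_l _ _ _ (Rlt_le _ _ Ru0) dif.
  have EBE : E * B <= E * 1 by apply: Rmult_le_compat_l; lra.
  have e7 : E - 7 * d = E - eps / 12 by rewrite dE; field.
  rewrite e7 in udif.
  have e1 : 0 <= E - eps / 12 <= 1 by lra.
  have H1 : (E - eps / 12) * (B * lam) <= (E - eps / 12) * (INR u * (tau * L) + tau * L).
    by apply: Rmult_le_compat_l; lra.
  have H2 : (E - eps / 12) * (tau * L) <= 1 * (tau * L) by apply: Rmult_le_compat_r; lra.
  have Bl : B * lam <= 1 * lam by apply: Rmult_le_compat_r; lra.
  have H3 : eps / 12 * (B * lam) <= eps / 12 * (1 * lam) by apply: Rmult_le_compat_l; lra.
  have := Rle_abs (ln (2 * A)); rewrite /c1; lra.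
- lra.
move=> C0 HC.
rewrite -(exp_ln (INR (Ccount _))) //; apply: exp_mono; apply: Rle_trans HC.
(* Between [c1 * exp W] and the target lies [2/3 * eps * exp W]. It covers the rounding of [t], the
   terms [T * W] and [2 * c1 * T], and the loss [n * ln (3 * x)]. *)
set T := exp W / (lam + 2) in T0 T1 T2 TE Tv.
have v1 : 1 <= v by lra.
have nl : INR n * ln (3 * x) <= v * (lam + 2).
  by apply: Rmult_le_compat; [exact: pos_INR|lra|lra|lra].
have vl : v * (8 * (lam + 2)) <= v * (eps * v) by apply: Rmult_le_compat_l; lra.
have tt : (T - 1) * (c1 * lam - W) <= INR t * (c1 * lam - ln (INR t)).
  by apply: Rmult_le_compat; lra.
have TW : T * (18 * W) <= T * (eps * lam) by apply: Rmult_le_compat_l; lra.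
have T3 : T * 54 <= T * (18 * W) by apply: Rmult_le_compat_l; lra.
have eT : eps * T * lam <= eps * (v * v).
  rewrite -vv -TE; have : 0 <= eps * T by apply: Rmult_le_pos; lra.
  lra.
have c1T : c1 * T <= 1 * T by apply: Rmult_le_compat_r; lra.
have ev : eps * v * 1 <= eps * v * v.
  by apply: Rmult_le_compat_l => //; apply: Rmult_le_pos; lra.
have cl : c1 * lam <= 1 * lam by apply: Rmult_le_compat_r; lra.
have Ew : c1 * exp W = c1 * (T * lam) + 2 * (c1 * T) by rewrite -TE; ring.
have : (E * B - eps) * exp W = c1 * exp W - 2 / 3 * (eps * exp W) by rewrite /c1; field.
rewrite vv in Ew *; move=> ->; lra.
Qed.

(* In [Defs], [inE] is a predicate on reals; mathcomp's rewrite rule hides it. *)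
Import Defs.

Theorem theorem2p4 (c A A' : R) (Hc : 0 < c < 1) (HBFM : BFM_property c)
  (HA : 0 < A) (HA' : 0 < A')
  (E B eps : R) (HE : inE E) (HE49 : 4 / 9 < E < 1)
  (HB : inB c A A' B) (Heps : 0 < eps) :
  exists x4 : R, forall x : R, x4 <= x ->
    INR (Ccount x) >= Rpower x (E * B - eps).
Proof.
have [E01 [x1 [gam [_ [gam0 HE1]]]]] := HE.
have [B01 [x2 HB2]] := HB.
have EB0 : 0 < E * B by apply: Rmult_lt_0_compat; lra.
(* [Ccount_lower] asks for [eps <= E * B]; shrinking [eps] only strengthens the bound. *)
have eps'0 : 0 < Rmin eps (E * B) by apply: Rmin_pos.
have [W0 HW0] := Ccount_lower HA HA' B01 E01 eps'0 (Rmin_r _ _) gam0 HE1 HB2.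
exists (exp (exp W0)) => x Hx; have x0 : 0 < x by have := exp_pos (exp W0); lra.
have lx : exp W0 <= ln x by rewrite -[X in X <= _]ln_exp; apply: ln_le => //; apply: exp_pos.
have lx0 : 0 < ln x by have := exp_pos W0; lra.
have lW : W0 <= ln (ln x) by rewrite -[X in X <= _]ln_exp; apply: ln_le => //; apply: exp_pos.
apply: Rle_ge; move: (HW0 _ lW); rewrite !exp_ln //; apply: Rle_trans.
apply: exp_mono; apply: Rmult_le_compat_r; first lra.
by have := Rmin_l eps (E * B); lra.
Qed.
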